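(* Let $\mathbf S$ be a category with finite products, and let $\mathscr C$ be an $\mathbf S$-indexed symmetric monoidal category with indexed homotopy coproducts preserved by $\otimes$. Then there is a bicategory $\mathscr C/_{\mathbf S}$ whose 0-cells are the objects of $\mathbf S$, with hom-categories $$\mathscr C/_{\mathbf S}(A,B)=\mathscr C^{A\times B},$$ and with composition (of $M\in\mathscr C^{A\times B}$ and $N\in\mathscr C^{B\times C}$) and units defined by $$M\odot N=(\mathrm{id}_A\times\pi_B\times\mathrm{id}_C)_!(\mathrm{id}_A\times\Delta_B\times\mathrm{id}_C)^*(M\boxtimes N),\qquad U_A=(\Delta_A)_!\pi_A^*(U).$$ Moreover, $\mathscr C/_{\mathbf S}$ has a shadow with values in $\mathscr C^\star$, defined for $M\in\mathscr C^{A\times A}$ by $$\langle\langle M\rangle\rangle=(\pi_A)_!(\Delta_A)^*M.$$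
   Context: **Indexed categories.** $\star$ is the terminal object of $\mathbf S$, $\pi_A\colon A\to\star$ the unique map and $\Delta_A\colon A\to A\times A$ the diagonal; canonical isomorphisms such as $A\times\star\cong A$ are suppressed. An $\mathbf S$-indexed symmetric monoidal category $\mathscr C$ is a pseudofunctor from $\mathbf S^{\mathrm{op}}$ to the 2-category of symmetric monoidal categories, strong symmetric monoidal functors and monoidal natural transformations; its value at $A$ is $(\mathscr C^A,\otimes_A,I_A)$ and its value at $f\colon A\to B$ is the reindexing functor $f^*\colon\mathscr C^B\to\mathscr C^A$. For $M\in\mathscr C^A$, $N\in\mathscr C^B$ the external product is $M\boxtimes N=(\mathrm{id}_A\times\pi_B)^*M\otimes_{A\times B}(\pi_A\times\mathrm{id}_B)^*N\in\mathscr C^{A\times B}$, and $U=I_\star$. **Indexed homotopy coproducts preserved by $\otimes$** means: each $f^*$ has a left adjoint $f_!$; for each square in a class of commutative squares of $\mathbf S$ called homotopy pullback squares, with top $f\colon A\to B$, left $h\colon A\to C$, right $g\colon B\to D$, bottom $k\colon C\to D$, the Beck-Chevalley morphism $f_!h^*\to f_!h^*k^*k_!\cong f_!f^*g^*k_!\to g^*k_!$ is an isomorphism; and for $f\colon A\to B$, $M\in\mathscr C^B$, $N\in\mathscr C^A$ the canonical map $f_!(f^*M\otimes N)\to f_!(f^*M\otimes f^*f_!N)\cong f_!f^*(M\otimes f_!N)\to M\otimes f_!N$ is an isomorphism (equivalently, the canonical maps $(f\times g)_!(M\boxtimes N)\to f_!M\boxtimes g_!N$ are isomorphisms). The class of homotopy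 pullback squares depends on the situation; it is only assumed to contain the following squares, their transposes, and all squares obtained from these by cartesian product with a fixed object: (a) top $f\times\mathrm{id}_C\colon A\times C\to B\times C$, left $\mathrm{id}_A\times g\colon A\times C\to A\times D$, right $\mathrm{id}_B\times g$, bottom $f\times\mathrm{id}_D$; (b) top and left $\Delta_A\colon A\to A\times A$, right $\mathrm{id}_A\times\Delta_A$, bottom $\Delta_A\times\mathrm{id}_A\colon A\times A\to A\times A\times A$; (c) for $f\colon A\to B$: top $(\mathrm{id}_A,f)\colon A\to A\times B$, left $f\colon A\to B$, right $f\times\mathrm{id}_B$, bottom $\Delta_B$. The square with top and left $\mathrm{id}_A$ and right and bottom $\Delta_A$ is not assumed to belong to it. **Shadows.** A shadow on a bicategory $\mathscr B$ (with associator $\mathfrak a$ and left and right unitors $\mathfrak l,\mathfrak r$) with values in a category $\mathbf T$ consists of functors $\langle\langle-\rangle\rangle\colon\mathscr B(R,R)\to\mathbf T$ for each 0-cell $R$, together with natural isomorphisms $\theta\colon\langle\langle M\odot N\rangle\rangle\to\langle\langle N\odot M\rangle\rangle$ for 1-cells $M\colon R\to S$, $N\colon S\to R$, such that, whenever they make sense: (1) the composite $\langle\langle(M\odot N)\odot P\rangle\rangle\xrightarrow{\theta}\langle\langle P\odot(M\odot N)\rangle\rangle\xrightarrow{\langle\langle\mathfrak a\rangle\rangle}\langle\langle(P\odot M)\odot N\rangle\rangle$ equals $\langle\langle(M\odot N)\odot P\rangle\rangle\xrightarrow{\langle\langle\mathfrak a\rangle\rangle}\langle\langle M\odot(N\odot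 P)\rangle\rangle\xrightarrow{\theta}\langle\langle(N\odot P)\odot M\rangle\rangle\xrightarrow{\langle\langle\mathfrak a\rangle\rangle}\langle\langle N\odot(P\odot M)\rangle\rangle\xrightarrow{\theta}\langle\langle(P\odot M)\odot N\rangle\rangle$ (with $\mathfrak a$ denoting the associator or its inverse as appropriate); (2) $\langle\langle\mathfrak l\rangle\rangle\circ\theta=\langle\langle\mathfrak r\rangle\rangle\colon\langle\langle M\odot U_R\rangle\rangle\to\langle\langle M\rangle\rangle$ and $\langle\langle\mathfrak r\rangle\rangle\circ\theta=\langle\langle\mathfrak l\rangle\rangle\colon\langle\langle U_R\odot M\rangle\rangle\to\langle\langle M\rangle\rangle$. *)

(* Defs.v *)
Set Implicit Arguments.
Unset Strict Implicit.
Unset Printing Implicit Defensive.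

Declare Scope cat_scope.
Delimit Scope cat_scope with cat.
Local Open Scope cat_scope.

Reserved Notation "x ~> y" (at level 70, no associativity).
Reserved Notation "g ∘ f" (at level 40, left associativity).
Reserved Notation "G ∘F F" (at level 40, left associativity).
Reserved Notation "x ⊗ y" (at level 35, right associativity).
Reserved Notation "f ⊗h g" (at level 35, right associativity).
Reserved Notation "A × B" (at level 34, right associativity).
Reserved Notation "f ×h g" (at level 34, right associativity).

Record Category := {
  ob :> Type;
  hom : ob -> ob -> Type;
  idm : forall x, hom x x;
  comp : forall x y z, hom y z -> hom x y -> hom x z;
  comp_id_l : forall x y (f : hom x y), comp (idm y) f = f;
  comp_id_r : forall x y (f : hom x y), comp f (idm x) = f;
  comp_assoc : forall x y z w (h : hom z w) (g : hom y z) (f : hom x y),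
    comp h (comp g f) = comp (comp h g) f
}.
Arguments hom {c} x y : rename.
Arguments idm {c} x : rename.
Arguments comp {c x y z} g f : rename.
Notation "x ~> y" := (hom x y) : cat_scope.
Notation "g ∘ f" := (comp g f) : cat_scope.

Definition is_iso (C : Category) (x y : C) (f : x ~> y) : Prop :=
  exists g : y ~> x, g ∘ f = idm x /\ f ∘ g = idm y.

Record Iso (C : Category) (x y : C) := {
  iso_hom :> x ~> y;
  inv : y ~> x;
  inv_l : inv ∘ iso_hom = idm x;
  inv_r : iso_hom ∘ inv = idm y
}.

Record Functor (C D : Category) := {
  fobj :> C -> D;
  fmap : forall x y : C, x ~> y -> fobj x ~> fobj y;
  fmap_id : forall x, fmap (idm x) = idm (fobj x);
  fmap_comp : forall x y z (g : y ~> z) (f : x ~> y),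
    fmap (g ∘ f) = fmap g ∘ fmap f
}.
Arguments fmap {C D} F {x y} f : rename.

Program Definition FComp (C D E : Category) (G : Functor D E) (F : Functor C D) :
    Functor C E :=
  {| fobj := fun x => G (F x); fmap := fun x y f => fmap G (fmap F f) |}.
Next Obligation. now intros; simpl; rewrite !fmap_id. Qed.
Next Obligation. now intros; simpl; rewrite !fmap_comp. Qed.
Notation "G ∘F F" := (FComp G F) : cat_scope.

Program Definition ProdCat (C D : Category) : Category :=
  {| ob := C * D;
     hom := fun x y => ((fst x ~> fst y) * (snd x ~> snd y))%type;
     idm := fun x => (idm (fst x), idm (snd x));
     comp := fun x y z g f => (fst g ∘ fst f, snd g ∘ snd f) |}.
Next Obligation. now intros; simpl; rewrite !comp_id_l; destruct f. Qed.
Next Obligation. now intros; simpl; rewrite !comp_id_r; destruct f. Qed.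
Next Obligation. now intros; simpl; rewrite !comp_assoc. Qed.

Definition fmap2 (C D E : Category) (F : Functor (ProdCat C D) E)
    (x x' : C) (y y' : D) (f : x ~> x') (g : y ~> y') : F (x, y) ~> F (x', y') :=
  @fmap _ _ F (x, y) (x', y') (f, g).

Program Definition FProd (C C' D D' : Category) (F : Functor C C') (G : Functor D D') :
    Functor (ProdCat C D) (ProdCat C' D') :=
  {| fobj := fun x => (F (fst x), G (snd x));
     fmap := fun x y f => (fmap F (fst f), fmap G (snd f)) |}.
Next Obligation. now intros; simpl; rewrite !fmap_id. Qed.
Next Obligation. now intros; simpl; rewrite !fmap_comp. Qed.

Record LeftAdjoint (C D : Category) (G : Functor D C) := {
  ladj :> Functor C D;
  adj_unit : forall x : C, x ~> G (ladj x);
  adj_counit : forall y : D, ladj (G y) ~> y;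
  unit_nat : forall (x x' : C) (f : x ~> x'),
    adj_unit x' ∘ f = fmap G (fmap ladj f) ∘ adj_unit x;
  counit_nat : forall (y y' : D) (f : y ~> y'),
    f ∘ adj_counit y = adj_counit y' ∘ fmap ladj (fmap G f);
  triangle_ladj : forall x : C, adj_counit (ladj x) ∘ fmap ladj (adj_unit x) = idm (ladj x);
  triangle_radj : forall y : D, fmap G (adj_counit y) ∘ adj_unit (G y) = idm (G y)
}.
Arguments adj_unit {C D G} L x : rename.
Arguments adj_counit {C D G} L y : rename.

Definition hom_of_eq (X : Type) (C : Category) (F : X -> C) (x y : X) (e : x = y) :
    F x ~> F y :=
  match e in _ = y return F x ~> F y with eq_refl => idm (F x) end.

Record CatWithFiniteProducts := {
  fp_cat :> Category;
  star : fp_cat;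
  proj : forall A : fp_cat, A ~> star;
  star_uniq : forall (A : fp_cat) (f g : A ~> star), f = g;
  bprod : fp_cat -> fp_cat -> fp_cat;
  pr1 : forall A B, bprod A B ~> A;
  pr2 : forall A B, bprod A B ~> B;
  pairing : forall X A B, X ~> A -> X ~> B -> X ~> bprod A B;
  pr1_pair : forall X A B (f : X ~> A) (g : X ~> B), pr1 A B ∘ pairing f g = f;
  pr2_pair : forall X A B (f : X ~> A) (g : X ~> B), pr2 A B ∘ pairing f g = g;
  pair_uniq : forall X A B (h : X ~> bprod A B), pairing (pr1 A B ∘ h) (pr2 A B ∘ h) = h
}.
Arguments star {S} : rename.
Arguments proj {S} A : rename.
Arguments bprod {S} A B : rename.
Arguments pr1 {S A B} : rename.
Arguments pr2 {S A B} : rename.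
Arguments pairing {S X A B} f g : rename.
Notation "A × B" := (bprod A B) : cat_scope.

Definition prod_map (S : CatWithFiniteProducts) (A B C D : S) (f : A ~> B) (g : C ~> D) :
    A × C ~> B × D :=
  pairing (f ∘ pr1) (g ∘ pr2).
Notation "f ×h g" := (prod_map f g) : cat_scope.

Definition diag (S : CatWithFiniteProducts) (A : S) : A ~> A × A :=
  pairing (idm A) (idm A).
Arguments diag {S} A.

(* The canonical isomorphisms (A × B) × C ≅ A × (B × C), A × ⋆ ≅ A and ⋆ × A ≅ A
   that are usually suppressed. *)
Definition passoc (S : CatWithFiniteProducts) (A B C : S) :
    (A × B) × C ~> A × (B × C) :=
  pairing (pr1 ∘ pr1) (pairing (pr2 ∘ pr1) pr2).
Definition passoc_inv (S : CatWithFiniteProducts) (A B C : S) :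
    A × (B × C) ~> (A × B) × C :=
  pairing (pairing pr1 (pr1 ∘ pr2)) (pr2 ∘ pr2).
Arguments passoc {S} A B C.
Arguments passoc_inv {S} A B C.
Definition prunit (S : CatWithFiniteProducts) (A : S) : A × star ~> A := pr1.
Definition plunit (S : CatWithFiniteProducts) (A : S) : star × A ~> A := pr2.
Arguments prunit {S} A.
Arguments plunit {S} A.

Record SymMonCat := {
  sm_cat :> Category;
  tensor : Functor (ProdCat sm_cat sm_cat) sm_cat;
  munit : sm_cat;
  massoc : forall x y z : sm_cat,
    Iso (tensor (tensor (x, y), z)) (tensor (x, tensor (y, z)));
  mlunit : forall x : sm_cat, Iso (tensor (munit, x)) x;
  mrunit : forall x : sm_cat, Iso (tensor (x, munit)) x;
  msym : forall x y : sm_cat, Iso (tensor (x, y)) (tensor (y, x));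
  massoc_nat : forall (x x' y y' z z' : sm_cat) (f : x ~> x') (g : y ~> y') (h : z ~> z'),
    fmap2 tensor f (fmap2 tensor g h) ∘ massoc x y z
    = massoc x' y' z' ∘ fmap2 tensor (fmap2 tensor f g) h;
  mlunit_nat : forall (x x' : sm_cat) (f : x ~> x'),
    f ∘ mlunit x = mlunit x' ∘ fmap2 tensor (idm munit) f;
  mrunit_nat : forall (x x' : sm_cat) (f : x ~> x'),
    f ∘ mrunit x = mrunit x' ∘ fmap2 tensor f (idm munit);
  msym_nat : forall (x x' y y' : sm_cat) (f : x ~> x') (g : y ~> y'),
    fmap2 tensor g f ∘ msym x y = msym x' y' ∘ fmap2 tensor f g;
  mpentagon : forall w x y z : sm_cat,
    massoc w x (tensor (y, z)) ∘ massoc (tensor (w, x)) y z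
    = fmap2 tensor (idm w) (massoc x y z) ∘ massoc w (tensor (x, y)) z
      ∘ fmap2 tensor (massoc w x y) (idm z);
  mtriangle : forall x y : sm_cat,
    fmap2 tensor (idm x) (mlunit y) ∘ massoc x munit y
    = fmap2 tensor (mrunit x) (idm y);
  msym_involutive : forall x y : sm_cat, msym y x ∘ msym x y = idm (tensor (x, y));
  mhexagon : forall x y z : sm_cat,
    massoc y z x ∘ msym x (tensor (y, z)) ∘ massoc x y z
    = fmap2 tensor (idm y) (msym x z) ∘ massoc y x z
      ∘ fmap2 tensor (msym x y) (idm z)
}.
Arguments tensor {V} : rename.
Arguments munit {V} : rename.
Arguments massoc {V} x y z : rename.
Arguments mlunit {V} x : rename.
Arguments mrunit {V} x : rename.
Arguments msym {V} x y : rename.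
Notation "x ⊗ y" := (tensor (x, y)) : cat_scope.
Notation "f ⊗h g" := (fmap2 tensor f g) : cat_scope.

Record StrongSymMonFunctor (V W : SymMonCat) := {
  ssm_fun :> Functor V W;
  fmul : forall x y : V, Iso (ssm_fun x ⊗ ssm_fun y) (ssm_fun (x ⊗ y));
  fone : Iso munit (ssm_fun munit);
  fmul_nat : forall (x x' y y' : V) (f : x ~> x') (g : y ~> y'),
    fmap ssm_fun (f ⊗h g) ∘ fmul x y = fmul x' y' ∘ (fmap ssm_fun f ⊗h fmap ssm_fun g);
  fmul_assoc : forall x y z : V,
    fmap ssm_fun (massoc x y z) ∘ fmul (x ⊗ y) z ∘ (fmul x y ⊗h idm (ssm_fun z))
    = fmul x (y ⊗ z) ∘ (idm (ssm_fun x) ⊗h fmul y z)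
      ∘ massoc (ssm_fun x) (ssm_fun y) (ssm_fun z);
  fmul_lunit : forall x : V,
    fmap ssm_fun (mlunit x) ∘ fmul munit x ∘ (fone ⊗h idm (ssm_fun x))
    = mlunit (ssm_fun x);
  fmul_runit : forall x : V,
    fmap ssm_fun (mrunit x) ∘ fmul x munit ∘ (idm (ssm_fun x) ⊗h fone)
    = mrunit (ssm_fun x);
  fmul_sym : forall x y : V,
    fmap ssm_fun (msym x y) ∘ fmul x y = fmul y x ∘ msym (ssm_fun x) (ssm_fun y)
}.
Arguments fmul {V W} F x y : rename.
Arguments fone {V W} F : rename.

(* A pseudofunctor S^op -> SymMonCat, unfolded: [re_id] and [re_comp] are invertible
   monoidal natural transformations Id => (id_A)^* and f^* g^* => (g f)^*.  As the
   2-cells of S are identities, the category laws of S enter the coherence axioms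
   through [hom_of_eq]. *)
Record IndexedSymMonCat (S : CatWithFiniteProducts) := {
  fibre :> S -> SymMonCat;
  re : forall A B : S, A ~> B -> StrongSymMonFunctor (fibre B) (fibre A);
  re_id : forall (A : S) (M : fibre A), Iso M (re (idm A) M);
  re_comp : forall (A B C : S) (f : A ~> B) (g : B ~> C) (M : fibre C),
    Iso (re f (re g M)) (re (g ∘ f) M);
  re_id_nat : forall (A : S) (M N : fibre A) (u : M ~> N),
    fmap (re (idm A)) u ∘ re_id M = re_id N ∘ u;
  re_comp_nat : forall (A B C : S) (f : A ~> B) (g : B ~> C) (M N : fibre C) (u : M ~> N),
    fmap (re (g ∘ f)) u ∘ re_comp f g M = re_comp f g N ∘ fmap (re f) (fmap (re g) u);
  re_id_mul : forall (A : S) (M N : fibre A),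
    re_id (M ⊗ N) = fmul (re (idm A)) M N ∘ (re_id M ⊗h re_id N) :> hom _ _;
  re_id_one : forall A : S,
    re_id (munit : fibre A) = fone (re (idm A)) :> hom _ _;
  re_comp_mul : forall (A B C : S) (f : A ~> B) (g : B ~> C) (M N : fibre C),
    re_comp f g (M ⊗ N) ∘ (fmap (re f) (fmul (re g) M N) ∘ fmul (re f) (re g M) (re g N))
    = fmul (re (g ∘ f)) M N ∘ (re_comp f g M ⊗h re_comp f g N);
  re_comp_one : forall (A B C : S) (f : A ~> B) (g : B ~> C),
    re_comp f g munit ∘ (fmap (re f) (fone (re g)) ∘ fone (re f)) = fone (re (g ∘ f));
  re_lunit : forall (A B : S) (f : A ~> B) (M : fibre B),
    hom_of_eq (fun h => re h M) (comp_id_l f) ∘ re_comp f (idm B) M ∘ fmap (re f) (re_id M)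
    = idm (re f M);
  re_runit : forall (A B : S) (f : A ~> B) (M : fibre B),
    hom_of_eq (fun h => re h M) (comp_id_r f) ∘ re_comp (idm A) f M ∘ re_id (re f M)
    = idm (re f M);
  re_assoc : forall (A B C D : S) (f : A ~> B) (g : B ~> C) (h : C ~> D) (M : fibre D),
    re_comp f (h ∘ g) M ∘ fmap (re f) (re_comp g h M)
    = hom_of_eq (fun k => re k M) (comp_assoc h g f)
      ∘ re_comp (g ∘ f) h M ∘ re_comp f g (re h M)
}.
Arguments re {S C A B} f : rename.
Arguments re_id {S C A} M : rename.
Arguments re_comp {S C A B C0} f g M : rename.

(* The arguments of a class of squares are, in order, the top f, the left h, the right g
   and the bottom k:
<<
        f
     A ---> B
   h |      | g
     v      v
     C ---> D
        k
>>
*)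
Definition SquareClass (S : Category) :=
  forall A B C D : S, A ~> B -> A ~> C -> B ~> D -> C ~> D -> Prop.

(* The canonical isomorphism in [base_diag] makes both composites land in
   A × (A × A). *)
Inductive base_square (S : CatWithFiniteProducts) : SquareClass S :=
| base_prod (A B C D : S) (f : A ~> B) (g : C ~> D) :
    base_square (f ×h idm C) (idm A ×h g) (idm B ×h g) (f ×h idm D)
| base_diag (A : S) :
    base_square (diag A) (diag A) (idm A ×h diag A) (passoc A A A ∘ (diag A ×h idm A))
| base_graph (A B : S) (f : A ~> B) :
    base_square (pairing (idm A) f) f (f ×h idm B) (diag B)
| base_transpose (A B C D : S) (f : A ~> B) (h : A ~> C) (g : B ~> D) (k : C ~> D) :
    base_square f h g k -> base_square h f k g.

Inductive required_square (S : CatWithFiniteProducts) : SquareClass S :=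
| req_base (A B C D : S) (f : A ~> B) (h : A ~> C) (g : B ~> D) (k : C ~> D) :
    base_square f h g k -> required_square f h g k
| req_prod_l (X A B C D : S) (f : A ~> B) (h : A ~> C) (g : B ~> D) (k : C ~> D) :
    base_square f h g k ->
    required_square (idm X ×h f) (idm X ×h h) (idm X ×h g) (idm X ×h k)
| req_prod_r (X A B C D : S) (f : A ~> B) (h : A ~> C) (g : B ~> D) (k : C ~> D) :
    base_square f h g k ->
    required_square (f ×h idm X) (h ×h idm X) (g ×h idm X) (k ×h idm X).

Section Comparisons.
Context (S : CatWithFiniteProducts) (C : IndexedSymMonCat S).
Context (push : forall (A B : S) (f : A ~> B), LeftAdjoint (@re S C A B f)).

Definition re_square (X Y Z W : S) (f : X ~> Y) (h : X ~> Z) (g : Y ~> W) (k : Z ~> W)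
    (e : g ∘ f = k ∘ h) (M : C W) : re h (re k M) ~> re f (re g M) :=
  inv (re_comp f g M) ∘ hom_of_eq (fun u => re u M) (eq_sym e) ∘ re_comp h k M.

Definition beck_chevalley_map (X Y Z W : S) (f : X ~> Y) (h : X ~> Z) (g : Y ~> W)
    (k : Z ~> W) (e : g ∘ f = k ∘ h) (M : C Z) :
    push f (re h M) ~> re g (push k M) :=
  adj_counit (push f) (re g (push k M))
  ∘ fmap (push f) (re_square e (push k M))
  ∘ fmap (push f) (fmap (re h) (adj_unit (push k) M)).

Definition projection_map (A B : S) (f : A ~> B) (M : C B) (N : C A) :
    push f (re f M ⊗ N) ~> M ⊗ push f N :=
  adj_counit (push f) (M ⊗ push f N)
  ∘ fmap (push f) (fmul (re f) M (push f N))
  ∘ fmap (push f) (idm (re f M) ⊗h adj_unit (push f) N).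
End Comparisons.

Record IndexedHomotopyCoproducts (S : CatWithFiniteProducts) (C : IndexedSymMonCat S) := {
  push : forall (A B : S) (f : A ~> B), LeftAdjoint (@re S C A B f);
  ho_pullback : SquareClass S;
  ho_pullback_comm : forall (X Y Z W : S) (f : X ~> Y) (h : X ~> Z) (g : Y ~> W) (k : Z ~> W),
    ho_pullback f h g k -> g ∘ f = k ∘ h;
  ho_pullback_required :
    forall (X Y Z W : S) (f : X ~> Y) (h : X ~> Z) (g : Y ~> W) (k : Z ~> W),
    required_square f h g k -> ho_pullback f h g k;
  beck_chevalley : forall (X Y Z W : S) (f : X ~> Y) (h : X ~> Z) (g : Y ~> W) (k : Z ~> W)
      (p : ho_pullback f h g k) (M : C Z),
    is_iso (beck_chevalley_map push (ho_pullback_comm p) M);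
  projection_formula : forall (A B : S) (f : A ~> B) (M : C B) (N : C A),
    is_iso (projection_map push f M N)
}.
Arguments push {S C} H {A B} f : rename.

(* A bicategory with prescribed 0-cells, hom-categories, composition and units.
   Composition is in diagrammatic order. *)
Record Bicategory (O : Type) (H : O -> O -> Category)
    (odot : forall R S T : O, Functor (ProdCat (H R S) (H S T)) (H R T))
    (U : forall R : O, H R R) := {
  bassoc : forall (R S T V : O) (M : H R S) (N : H S T) (P : H T V),
    Iso (odot R T V (odot R S T (M, N), P)) (odot R S V (M, odot S T V (N, P)));
  blunit : forall (R S : O) (M : H R S), Iso (odot R R S (U R, M)) M;
  brunit : forall (R S : O) (M : H R S), Iso (odot R S S (M, U S)) M;
  bassoc_nat : forall (R S T V : O) (M M' : H R S) (N N' : H S T) (P P' : H T V)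
      (f : M ~> M') (g : N ~> N') (h : P ~> P'),
    fmap2 (odot R S V) f (fmap2 (odot S T V) g h) ∘ bassoc M N P
    = bassoc M' N' P' ∘ fmap2 (odot R T V) (fmap2 (odot R S T) f g) h;
  blunit_nat : forall (R S : O) (M M' : H R S) (f : M ~> M'),
    f ∘ blunit M = blunit M' ∘ fmap2 (odot R R S) (idm (U R)) f;
  brunit_nat : forall (R S : O) (M M' : H R S) (f : M ~> M'),
    f ∘ brunit M = brunit M' ∘ fmap2 (odot R S S) f (idm (U S));
  bpentagon : forall (R S T V W : O) (M : H R S) (N : H S T) (P : H T V) (Q : H V W),
    bassoc M N (odot T V W (P, Q)) ∘ bassoc (odot R S T (M, N)) P Q
    = fmap2 (odot R S W) (idm M) (bassoc N P Q) ∘ bassoc M (odot S T V (N, P)) Q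
      ∘ fmap2 (odot R V W) (bassoc M N P) (idm Q);
  btriangle : forall (R S T : O) (M : H R S) (N : H S T),
    fmap2 (odot R S T) (idm M) (blunit N) ∘ bassoc M (U S) N
    = fmap2 (odot R S T) (brunit M) (idm N)
}.
Arguments bassoc {O H odot U} B {R S T V} M N P : rename.
Arguments blunit {O H odot U} B {R S} M : rename.
Arguments brunit {O H odot U} B {R S} M : rename.

Record Shadow (O : Type) (H : O -> O -> Category)
    (odot : forall R S T : O, Functor (ProdCat (H R S) (H S T)) (H R T))
    (U : forall R : O, H R R) (B : Bicategory odot U)
    (T : Category) (sh : forall R : O, Functor (H R R) T) := {
  theta : forall (R S : O) (M : H R S) (N : H S R),
    Iso (sh R (odot R S R (M, N))) (sh S (odot S R S (N, M)));
  theta_nat : forall (R S : O) (M M' : H R S) (N N' : H S R) (f : M ~> M') (g : N ~> N'),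
    fmap (sh S) (fmap2 (odot S R S) g f) ∘ theta M N
    = theta M' N' ∘ fmap (sh R) (fmap2 (odot R S R) f g);
  theta_assoc : forall (R S V : O) (M : H R S) (N : H S V) (P : H V R),
    fmap (sh V) (inv (bassoc B P M N)) ∘ theta (odot R S V (M, N)) P
    = theta N (odot V R S (P, M))
      ∘ fmap (sh S) (bassoc B N P M)
      ∘ theta M (odot S V R (N, P))
      ∘ fmap (sh R) (bassoc B M N P);
  theta_runit : forall (R : O) (M : H R R),
    fmap (sh R) (blunit B M) ∘ theta M (U R) = fmap (sh R) (brunit B M);
  theta_lunit : forall (R : O) (M : H R R),
    fmap (sh R) (brunit B M) ∘ theta (U R) M = fmap (sh R) (blunit B M)
}.

Section Cells.
Context (S : CatWithFiniteProducts) (C : IndexedSymMonCat S).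
Context (H : IndexedHomotopyCoproducts C).

(* The projections A × B ~> A and A × B ~> B are written as id × π_B and π_A × id
   followed by the canonical isomorphisms; likewise below. *)
Definition ext_prod (A B : S) : Functor (ProdCat (C A) (C B)) (C (A × B)) :=
  tensor ∘F FProd (re (prunit A ∘ (idm A ×h proj B))) (re (plunit B ∘ (proj A ×h idm B))).

Definition contract_mid (A B D : S) : A × (B × D) ~> A × D :=
  idm A ×h (plunit D ∘ (proj B ×h idm D)).

Definition diag_mid (A B D : S) : A × (B × D) ~> (A × B) × (B × D) :=
  passoc_inv A B (B × D) ∘ (idm A ×h (passoc B B D ∘ (diag B ×h idm D))).

Definition odot (A B D : S) :
    Functor (ProdCat (C (A × B)) (C (B × D))) (C (A × D)) :=
  push H (contract_mid A B D) ∘F re (diag_mid A B D) ∘F ext_prod (A × B) (B × D).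

Definition ucell (A : S) : C (A × A) := push H (diag A) (re (proj A) munit).

Definition shadow (A : S) : Functor (C (A × A)) (C star) :=
  push H (proj A) ∘F re (diag A).
End Cells.

(* Main.v *)
From Stdlib Require Import ssreflect ClassicalEpsilon ProofIrrelevance.
Require Import Defs.
Set Implicit Arguments.
Unset Strict Implicit.
Unset Printing Implicit Defensive.
Local Open Scope cat_scope.

(** Write [M(a,b)] for the reindexing in C^X of M in C^(A × B) along a pair of generalized
    elements a : X ~> A and b : X ~> B.  All the structure is then carried by three maps,
    natural in X,
<<
      eta  : M(a,b) ⊗ N(b,d) ~> (M ⊙ N)(a,d)
      iota : I ~> U(b,b)
      tr   : M(a,a) ~> <<M>>
>>
    which come from the units of the adjunctions defining composition, units and the
    shadow.  They are universal: a natural map out of (M ⊙ N)(a,d) is the same as a natural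
    map out of M(a,b) ⊗ N(b,d), where b is an additional free variable; a natural map out
    of U(b,b') is the same as a natural map out of I after setting b' = b; and a map out of
    the shadow of M is the same as a natural map out of M(a,a).  This remains true after
    tensoring with other factors that do not involve the eliminated variable.  So the
    1-cells with these maps form a multicategory-like structure in which composites are
    representable, and a 2-cell out of an iterated composite is determined by, and can be
    prescribed by, a natural map out of the corresponding iterated tensor product.

    Hence the associator, the unitors and the shadow isomorphism are the 2-cells induced by
    the associator, the unitors and the symmetry of ⊗, and every axiom of a bicategory with
    a shadow follows from the axiom of the same shape for the symmetric monoidal fibres:
    the pentagon and the triangle from theirs, the cyclic axiom of the shadow from
    [msym_rotation], and the unit axioms of the shadow from [mlunit_msym].

    Universality is where the hypotheses on C enter.  A map E ~> q^* D is opcartesian when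
    it exhibits D as the pushforward of E along q.  The projection formula says that
    opcartesian maps are stable under tensoring with a reindexed object ([opc_tensor]), and
    the Beck-Chevalley condition says that they are stable under reindexing along certain
    squares, here called exact ([exact_ho_pullback]).  Exact squares paste, and squares with
    two parallel isomorphisms are exact.  For eta the square needed at an arbitrary pair
    (a,d) is, up to isomorphisms, the product square of (a,d) with B ~> 1 ([exact_mid]); for
    iota it is the graph square of b ([exact_graph_l], [exact_graph_r]); for tr the
    adjunction suffices.

    Naturality in X is organized by contexts, which are representable presheaves of tuples
    of variables, and families of objects of the fibres indexed by the points of a context.
    A family carries its reindexing isomorphisms, so that the coherence of the pseudofunctor
    C is settled when families are built out of atoms M(a,b), tensor products and units, and
    does not reappear in the verification of the axioms. *)

(** * Isomorphisms and symmetric monoidal coherence *)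

Lemma comp_tail (C : Category) (x y z w : C) (g : y ~> z) (f : x ~> y) (k : x ~> z) :
  g ∘ f = k -> forall t : w ~> x, g ∘ (f ∘ t) = k ∘ t.
Proof. by move=> <- t; rewrite comp_assoc. Qed.

Lemma comp_tail3 (C : Category) (x y z u w : C) (h : z ~> u) (g : y ~> z) (f : x ~> y)
    (k : x ~> u) :
  h ∘ (g ∘ f) = k -> forall t : w ~> x, h ∘ (g ∘ (f ∘ t)) = k ∘ t.
Proof. by move=> <- t; rewrite !comp_assoc. Qed.

Ltac assoc_r := repeat rewrite <- comp_assoc.

Lemma inv_l_tail (C : Category) (x y w : C) (i : Iso x y) (t : w ~> x) : inv i ∘ (i ∘ t) = t.
Proof. by rewrite (comp_tail (inv_l i)) comp_id_l. Qed.

Lemma inv_r_tail (C : Category) (x y w : C) (i : Iso x y) (t : w ~> y) : i ∘ (inv i ∘ t) = t.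
Proof. by rewrite (comp_tail (inv_r i)) comp_id_l. Qed.

Lemma iso_monic (C : Category) (x y w : C) (i : Iso x y) (f g : w ~> x) :
  i ∘ f = i ∘ g -> f = g.
Proof. by move=> e; rewrite -(inv_l_tail i f) e inv_l_tail. Qed.

Lemma iso_epic (C : Category) (x y w : C) (i : Iso x y) (f g : y ~> w) :
  f ∘ i = g ∘ i -> f = g.
Proof.
move=> e; rewrite -(comp_id_r f) -(comp_id_r g) -(inv_r i).
by rewrite !comp_assoc e.
Qed.

Lemma inv_monic (C : Category) (x y w : C) (i : Iso x y) (f g : w ~> y) :
  inv i ∘ f = inv i ∘ g -> f = g.
Proof. by move=> e; rewrite -(inv_r_tail i f) e inv_r_tail. Qed.

Definition iso_sym (C : Category) (x y : C) (i : Iso x y) : Iso y x :=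
  {| iso_hom := inv i; inv := i; inv_l := inv_r i; inv_r := inv_l i |}.

Definition iso_id (C : Category) (x : C) : Iso x x :=
  {| iso_hom := idm x; inv := idm x; inv_l := comp_id_l _; inv_r := comp_id_l _ |}.

Lemma iso_comp_spec (C : Category) (x y z : C) (j : Iso y z) (i : Iso x y) :
  {k : Iso x z | iso_hom k = j ∘ i /\ inv k = inv i ∘ inv j}.
Proof.
have l : (inv i ∘ inv j) ∘ (j ∘ i) = idm x by assoc_r; rewrite inv_l_tail inv_l.
have r : (j ∘ i) ∘ (inv i ∘ inv j) = idm z by assoc_r; rewrite inv_r_tail inv_r.
by exists (Build_Iso l r).
Qed.

(** The composite is hidden behind an opaque lemma, so that rewriting by associativity
    treats a composite isomorphism as a single arrow. *)
Definition iso_comp (C : Category) (x y z : C) (j : Iso y z) (i : Iso x y) : Iso x z :=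
  proj1_sig (iso_comp_spec j i).

Lemma iso_compE (C : Category) (x y z : C) (j : Iso y z) (i : Iso x y) :
  iso_hom (iso_comp j i) = j ∘ i.
Proof. by case: (proj2_sig (iso_comp_spec j i)). Qed.

Lemma iso_comp_inv (C : Category) (x y z : C) (j : Iso y z) (i : Iso x y) :
  inv (iso_comp j i) = inv i ∘ inv j.
Proof. by case: (proj2_sig (iso_comp_spec j i)). Qed.

Definition iso_fmap (C D : Category) (F : Functor C D) (x y : C) (i : Iso x y) :
  Iso (F x) (F y).
Proof.
refine {| iso_hom := fmap F i; inv := fmap F (inv i) |}.
- by rewrite -fmap_comp inv_l fmap_id.
- by rewrite -fmap_comp inv_r fmap_id.
Defined.

Lemma fmap2_comp (C D E : Category) (F : Functor (ProdCat C D) E)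
    (x x' x'' : C) (y y' y'' : D) (f' : x' ~> x'') (f : x ~> x') (g' : y' ~> y'') (g : y ~> y') :
  fmap2 F f' g' ∘ fmap2 F f g = fmap2 F (f' ∘ f) (g' ∘ g).
Proof. by rewrite /fmap2 -fmap_comp. Qed.

Lemma fmap2_id (C D E : Category) (F : Functor (ProdCat C D) E) (x : C) (y : D) :
  fmap2 F (idm x) (idm y) = idm (F (x, y)).
Proof. by rewrite /fmap2 -fmap_id. Qed.

Definition iso_fmap2 (C D E : Category) (F : Functor (ProdCat C D) E)
    (x x' : C) (y y' : D) (i : Iso x x') (j : Iso y y') : Iso (F (x, y)) (F (x', y')).
Proof.
refine {| iso_hom := fmap2 F i j; inv := fmap2 F (inv i) (inv j) |}.
- by rewrite fmap2_comp !inv_l fmap2_id.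
- by rewrite fmap2_comp !inv_r fmap2_id.
Defined.

Section Monoidal.
Context (V : SymMonCat).

Lemma tensor_unit_l_faithful (x y : V) (f g : x ~> y) :
  idm munit ⊗h f = idm munit ⊗h g -> f = g.
Proof.
by move=> e; apply: (iso_epic (i := mlunit x)); rewrite !mlunit_nat e.
Qed.

Lemma tensor_unit_r_faithful (x y : V) (f g : x ~> y) :
  f ⊗h idm munit = g ⊗h idm munit -> f = g.
Proof.
by move=> e; apply: (iso_epic (i := mrunit x)); rewrite !mrunit_nat e.
Qed.

(** Kelly's redundant unit axiom: after tensoring with I on the left, which is faithful, it
    follows from the pentagon and the triangle for I, I, x, y. *)
Lemma mlunit_tensor (x y : V) :
  mlunit (x ⊗ y) ∘ massoc munit x y = mlunit x ⊗h idm y.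
Proof.
apply: tensor_unit_l_faithful.
pose i := iso_comp (massoc munit (munit ⊗ x) y)
            (iso_fmap2 tensor (massoc munit munit x) (iso_id y)).
apply: (iso_epic (i := i)); rewrite /i iso_compE /=.
have e := mpentagon munit munit x y.
rewrite -[idm munit in LHS](comp_id_l (idm munit)) -fmap2_comp.
assoc_r; rewrite -comp_assoc in e; rewrite -e.
rewrite (comp_tail (mtriangle _ _)).
rewrite (comp_tail (massoc_nat _ _ _)); assoc_r.
rewrite fmap2_comp mtriangle comp_id_l.
by rewrite -massoc_nat fmap2_id.
Qed.

(** The compatibility of the symmetry with the unitors: the hexagon for x, I, I, composed
    with the left unitor. *)
Lemma mlunit_msym (x : V) : mlunit x ∘ msym x munit = mrunit x.
Proof.
apply: tensor_unit_r_faithful; apply: (iso_monic (i := msym x munit)).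
rewrite -{1}(comp_id_l (idm munit)) -fmap2_comp -mlunit_tensor.
have e := mhexagon x munit munit.
rewrite -mtriangle [in RHS]comp_assoc -(msym_nat (idm x) (mlunit munit)).
rewrite -mlunit_tensor; assoc_r; rewrite -comp_assoc in e; rewrite e.
by rewrite (comp_tail (mlunit_nat _)); assoc_r.
Qed.

Lemma mrunit_msym (x : V) : mrunit x ∘ msym munit x = mlunit x.
Proof. by rewrite -mlunit_msym -comp_assoc msym_involutive comp_id_r. Qed.

(** The coherence behind the cyclic axiom of the shadow: rotating x ⊗ y past z at once, or
    first x past y ⊗ z and then y past z ⊗ x. *)
Lemma msym_rotation (x y z : V) :
  inv (massoc z x y) ∘ msym (x ⊗ y) z
  = msym y (z ⊗ x) ∘ massoc y z x ∘ msym x (y ⊗ z) ∘ massoc x y z.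
Proof.
have h1 := mhexagon x y z.
have h2 := mhexagon y x z.
have h3 := mhexagon z x y.
have -> : msym y (z ⊗ x) ∘ massoc y z x ∘ msym x (y ⊗ z) ∘ massoc x y z
    = (msym x z ⊗h idm y) ∘ inv (massoc x z y) ∘ (idm x ⊗h msym y z) ∘ massoc x y z.
  rewrite -!comp_assoc in h1 h2 *; rewrite h1 (comp_tail (eq_sym (msym_nat _ _))); assoc_r.
  congr (_ ∘ _); apply: (iso_monic (i := massoc x z y)); rewrite inv_r_tail (comp_tail3 h2).
  by assoc_r; rewrite fmap2_comp msym_involutive comp_id_l fmap2_id comp_id_r.
(* Compare with the third hexagon by cancelling the inverse of the rotation on the left. *)
apply: (iso_epic (i := msym z (x ⊗ y))).
rewrite -!comp_assoc msym_involutive comp_id_r.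
apply: (iso_epic (i := massoc z x y)); rewrite inv_l.
rewrite -!comp_assoc in h3 *; rewrite h3.
rewrite (comp_tail (fmap2_comp _ _ _ _ _)) msym_involutive comp_id_l fmap2_id comp_id_l.
by rewrite inv_l_tail fmap2_comp msym_involutive comp_id_l fmap2_id.
Qed.

End Monoidal.

(** * Reindexing along composable maps *)

Section Reindexing.
Context (S : CatWithFiniteProducts) (C : IndexedSymMonCat S).

Definition cast_iso (X : Type) (D : Category) (F : X -> D) (x y : X) (e : x = y) :
    Iso (F x) (F y) :=
  match e in _ = y return Iso (F x) (F y) with eq_refl => iso_id (F x) end.

Lemma cast_isoE (X : Type) (D : Category) (F : X -> D) (x y : X) (e : x = y) :
  cast_iso F e = hom_of_eq F e :> (_ ~> _).
Proof. by case: _ / e. Qed.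

Lemma pb_spec (X Y Z : S) (h : Y ~> X) (f : X ~> Z) (f' : Y ~> Z) (e : f ∘ h = f') (M : C Z) :
  {i : Iso (re h (re f M)) (re f' M)
   | i = iso_comp (cast_iso (fun k => re k M) e) (re_comp h f M)}.
Proof. by eexists. Qed.

(** [re_comp] with the composite given up to a proof of equality.  With proof irrelevance
    this absorbs all the transports along associativity and unit laws of S. *)
Definition pb (X Y Z : S) (h : Y ~> X) (f : X ~> Z) (f' : Y ~> Z) (e : f ∘ h = f') (M : C Z) :
    Iso (re h (re f M)) (re f' M) :=
  proj1_sig (pb_spec e M).

Lemma pbE (X Y Z : S) (h : Y ~> X) (f : X ~> Z) (f' : Y ~> Z) (e : f ∘ h = f') (M : C Z) :
  pb e M = iso_comp (cast_iso (fun k => re k M) e) (re_comp h f M).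
Proof. exact: proj2_sig (pb_spec e M). Qed.

Lemma pb_refl (X Y Z : S) (h : Y ~> X) (f : X ~> Z) (e : f ∘ h = f ∘ h) (M : C Z) :
  pb e M = re_comp h f M :> (_ ~> _).
Proof. by rewrite (proof_irrelevance _ e eq_refl) pbE !iso_compE /= comp_id_l. Qed.

Lemma pb_nat (X Y Z : S) (h : Y ~> X) (f : X ~> Z) (f' : Y ~> Z) (e : f ∘ h = f')
    (M N : C Z) (u : M ~> N) :
  fmap (re f') u ∘ pb e M = pb e N ∘ fmap (re h) (fmap (re f) u).
Proof. by case: _ / e; rewrite !pb_refl re_comp_nat. Qed.

(** The coherence of reindexing along three composable maps, free of transports. *)
Lemma pb_comp (W X Y Z : S) (k : W ~> Y) (h : Y ~> X) (n : W ~> X) (f : X ~> Z)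
    (f' : Y ~> Z) (f'' : W ~> Z) (en : h ∘ k = n) (e : f ∘ h = f') (e' : f' ∘ k = f'')
    (e'' : f ∘ n = f'') (M : C Z) :
  pb e' M ∘ fmap (re k) (pb e M) = pb e'' M ∘ pb en (re f M).
Proof.
subst n f' f''; rewrite !pb_refl re_assoc !pbE !iso_compE !cast_isoE.
by rewrite (proof_irrelevance _ e'' (comp_assoc f h k)).
Qed.

Lemma pb_id (X Z : S) (f : X ~> Z) (e : f ∘ idm X = f) (M : C Z) :
  pb e M ∘ re_id (re f M) = idm _.
Proof.
rewrite -(re_runit f M) (proof_irrelevance _ e (comp_id_r f)) !pbE !iso_compE !cast_isoE.
by [].
Qed.

Lemma pb_mul (X Y Z : S) (h : Y ~> X) (f : X ~> Z) (f' : Y ~> Z) (e : f ∘ h = f') (M N : C Z) :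
  pb e (M ⊗ N) ∘ (fmap (re h) (fmul (re f) M N) ∘ fmul (re h) (re f M) (re f N))
  = fmul (re f') M N ∘ (pb e M ⊗h pb e N).
Proof. by case: _ / e; rewrite !pb_refl re_comp_mul. Qed.

Lemma pb_one (X Y Z : S) (h : Y ~> X) (f : X ~> Z) (f' : Y ~> Z) (e : f ∘ h = f') :
  pb e munit ∘ (fmap (re h) (fone (re f)) ∘ fone (re h)) = fone (re f').
Proof. by case: _ / e; rewrite pb_refl re_comp_one. Qed.

Lemma re_squareE (X Y Z W : S) (f : X ~> Y) (h : X ~> Z) (g : Y ~> W) (k : Z ~> W) (y : X ~> W)
    (e : g ∘ f = k ∘ h) (r : g ∘ f = y) (r' : k ∘ h = y) (M : C W) :
  re_square e M = inv (pb r M) ∘ pb r' M.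
Proof.
subst y; rewrite (proof_irrelevance _ e (eq_sym r')) /re_square eq_sym_involutive.
by rewrite !pbE iso_comp_inv iso_compE cast_isoE /= comp_id_r comp_assoc.
Qed.

Section ReindexIso.
Context (X Z : S) (j : Iso X Z).

Definition re_retract (M : C Z) : Iso (re (inv j) (re j M)) M :=
  iso_comp (iso_sym (re_id M)) (pb (inv_r j) M).

Lemma re_retractE (M : C Z) : iso_hom (re_retract M) = inv (re_id M) ∘ pb (inv_r j) M.
Proof. exact: iso_compE. Qed.

Lemma re_retract_nat (M N : C Z) (u : M ~> N) :
  u ∘ re_retract M = re_retract N ∘ fmap (re (inv j)) (fmap (re j) u).
Proof.
rewrite !re_retractE -comp_assoc -pb_nat; apply: (iso_monic (i := re_id N)).
by rewrite inv_r_tail (comp_tail (eq_sym (re_id_nat u))) -comp_assoc inv_r_tail.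
Qed.

Lemma re_iso_faithful (M N : C Z) (u v : M ~> N) :
  fmap (re j) u = fmap (re j) v -> u = v.
Proof.
by move=> e; apply: (iso_epic (i := re_retract M)); rewrite !re_retract_nat e.
Qed.
End ReindexIso.

(** Together with faithfulness, reindexing along an isomorphism is fully faithful: v is
    obtained by reindexing back along the inverse. *)
Lemma re_iso_full (X Z : S) (j : Iso X Z) (M N : C Z) (v : re j M ~> re j N) :
  exists u : M ~> N, fmap (re j) u = v.
Proof.
exists (re_retract j N ∘ fmap (re (inv j)) v ∘ inv (re_retract j M)).
apply: (re_iso_faithful (j := iso_sym j)).
apply: (iso_monic (i := re_retract j N)); rewrite -re_retract_nat.
by assoc_r; rewrite inv_l comp_id_r.
Qed.

End Reindexing.

(** * Opcartesian maps and exact squares *)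

Section Opcartesian.
Context (S : CatWithFiniteProducts) (C : IndexedSymMonCat S).

(** Existence and uniqueness together, since both the construction of 2-cells and the proof
    of equations between them go through this property. *)
Definition Opcartesian (X Z : S) (q : X ~> Z) (E : C X) (D : C Z) (phi : E ~> re q D) : Prop :=
  forall (W : C Z) (psi : E ~> re q W),
    exists u : D ~> W, fmap (re q) u ∘ phi = psi
      /\ forall u' : D ~> W, fmap (re q) u' ∘ phi = psi -> u' = u.

Lemma opc_pre (X Z : S) (q : X ~> Z) (E E' : C X) (D : C Z) (phi : E ~> re q D) (i : Iso E' E) :
  Opcartesian phi -> Opcartesian (phi ∘ i).
Proof.
move=> op W psi; have [u [e1 e2]] := op W (psi ∘ inv i).
exists u; split.
  by rewrite comp_assoc e1 -comp_assoc inv_l comp_id_r.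
by move=> u' e; apply: e2; rewrite -e -!comp_assoc inv_r comp_id_r.
Qed.

Lemma opc_post (X Z : S) (q : X ~> Z) (E : C X) (D D' : C Z) (phi : E ~> re q D) (i : Iso D D') :
  Opcartesian phi -> Opcartesian (fmap (re q) i ∘ phi).
Proof.
move=> op W psi; have [u [e1 e2]] := op W psi.
exists (u ∘ inv i); split.
  by rewrite comp_assoc -fmap_comp -comp_assoc inv_l comp_id_r.
move=> u' e; apply: (iso_epic (i := i)); rewrite -comp_assoc inv_l comp_id_r.
by apply: e2; rewrite fmap_comp -comp_assoc.
Qed.

Lemma opc_comp (X Y Z : S) (f : X ~> Y) (g : Y ~> Z) (q : X ~> Z) (r : g ∘ f = q)
    (E : C X) (D : C Y) (G : C Z) (psi : E ~> re f D) (phi : D ~> re g G) :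
  Opcartesian psi -> Opcartesian phi ->
  Opcartesian (pb r G ∘ (fmap (re f) phi ∘ psi)).
Proof.
move=> op1 op2 W t; have [v [e1 e2]] := op1 _ (inv (pb r W) ∘ t).
have [u [e3 e4]] := op2 _ v; exists u; split.
  rewrite (comp_tail (pb_nat _ _)); assoc_r.
  by rewrite (comp_tail (eq_sym (fmap_comp _ _ _))) e3 e1 inv_r_tail.
move=> u' e; apply: e4; apply: e2; apply: (iso_monic (i := pb r W)).
rewrite inv_r_tail -e (comp_tail (pb_nat _ _)); assoc_r.
by rewrite (comp_tail (eq_sym (fmap_comp _ _ _))).
Qed.

Section Adjoint.
Context (X Z : S) (q : X ~> Z) (L : LeftAdjoint (@re S C X Z q)).

Lemma mate_unit (E : C X) (D : C Z) (phi : E ~> re q D) :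
  fmap (re q) (adj_counit L D ∘ fmap L phi) ∘ adj_unit L E = phi.
Proof.
by rewrite fmap_comp -comp_assoc -unit_nat comp_assoc triangle_radj comp_id_l.
Qed.

Lemma unit_mate (E : C X) (D : C Z) (u : L E ~> D) :
  adj_counit L D ∘ fmap L (fmap (re q) u ∘ adj_unit L E) = u.
Proof.
by rewrite fmap_comp comp_assoc -counit_nat -comp_assoc triangle_ladj comp_id_r.
Qed.

Lemma opc_unit (E : C X) : Opcartesian (adj_unit L E).
Proof.
move=> W psi; exists (adj_counit L W ∘ fmap L psi); split; first exact: mate_unit.
by move=> u' <-; rewrite unit_mate.
Qed.

(** The maps required to be invertible in the projection formula and in the Beck-Chevalley
    condition are mates; this turns their invertibility into a universal property. *)
Lemma opc_of_mate (E : C X) (D : C Z) (phi : E ~> re q D) :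
  is_iso (adj_counit L D ∘ fmap L phi) -> Opcartesian phi.
Proof.
case=> m [ml mr]; rewrite -(mate_unit phi).
exact: (opc_post (Build_Iso ml mr) (@opc_unit E)).
Qed.

(** Pushforwards are unique up to isomorphism, so properties of opcartesian maps need only
    be checked on units of adjunctions. *)
Lemma opc_is_unit (E : C X) (D : C Z) (phi : E ~> re q D) :
  Opcartesian phi -> exists m : Iso (L E) D, phi = fmap (re q) m ∘ adj_unit L E.
Proof.
move=> op; have [m [e1 _]] := @opc_unit E D phi.
have [n [e2 _]] := op _ (adj_unit L E).
have ml : n ∘ m = idm _.
  have [u [_ un]] := @opc_unit E _ (adj_unit L E).
  rewrite (un (idm _)) ?fmap_id ?comp_id_l //; apply: un.
  by rewrite fmap_comp -comp_assoc e1.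
have mr : m ∘ n = idm _.
  have [u [_ un]] := op _ phi.
  rewrite (un (idm _)) ?fmap_id ?comp_id_l //; apply: un.
  by rewrite fmap_comp -comp_assoc e2.
by exists (Build_Iso ml mr); rewrite e1.
Qed.
End Adjoint.

(** Beck-Chevalley as stability of opcartesian maps under pullback.  The common diagonal [y]
    is a separate variable, so that neither composite is preferred. *)
Definition ExactSquare (X Y Z W : S) (f : X ~> Y) (h : X ~> Z) (g : Y ~> W) (k : Z ~> W) : Prop :=
  forall (E : C Z) (D : C W) (phi : E ~> re k D), Opcartesian phi ->
  forall (y : X ~> W) (r : g ∘ f = y) (r' : k ∘ h = y),
    Opcartesian (inv (pb r D) ∘ (pb r' D ∘ fmap (re h) phi)).

Lemma exact_paste (X' Y' X Y Z W : S) (f : X ~> Y) (h : X ~> Z) (g : Y ~> W) (k : Z ~> W)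
    (f' : X' ~> Y') (h' : X' ~> X) (g' : Y' ~> Y) :
  g ∘ f = k ∘ h -> g' ∘ f' = f ∘ h' ->
  ExactSquare f h g k -> ExactSquare f' h' g' f ->
  ExactSquare f' (h ∘ h') (g ∘ g') k.
Proof.
move=> s s' ex ex' E D phi op y r r'.
have op1 := ex _ _ _ op _ s eq_refl.
have op2 := ex' _ _ _ op1 _ s' eq_refl.
have op3 := opc_post (re_comp g' g D) (opc_pre (iso_sym (re_comp h' h E)) op2).
have e1 : (k ∘ h) ∘ h' = y by rewrite -comp_assoc.
have e2 : g ∘ (f ∘ h') = y by rewrite comp_assoc s e1.
have e3 : (g ∘ g') ∘ f' = y by [].
congr (Opcartesian _): op3; rewrite /=.
apply: (iso_monic (i := pb r D)); rewrite inv_r_tail.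
have c1 := pb_comp s' (eq_refl (g ∘ g')) r e2 D.
rewrite pb_refl in c1; rewrite (comp_tail c1); assoc_r; rewrite inv_r_tail.
have c2 := pb_comp (eq_refl (f ∘ h')) s e1 e2 D.
rewrite comp_assoc comp_assoc -c2; assoc_r.
rewrite !(comp_tail (eq_sym (fmap_comp _ _ _))) inv_r_tail.
have c3 := pb_comp (eq_refl (h ∘ h')) (eq_refl (k ∘ h)) e1 r' D.
rewrite fmap_comp; assoc_r; rewrite (comp_tail c3) pb_refl; assoc_r.
by rewrite (comp_tail (eq_sym (re_comp_nat _ _ _))) -comp_assoc inv_r comp_id_r.
Qed.

(** Reindexing along [i] and [j] is an equivalence, and opcartesianness is invariant under
    it. *)
Lemma exact_iso (X Y Z W : S) (f : X ~> Y) (i : Iso X Z) (j : Iso Y W) (k : Z ~> W) :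
  ExactSquare f i j k.
Proof.
move=> E D phi op y r r'.
(* First change the source only, so that the map lies over [y]. *)
have opki : Opcartesian (pb r' D ∘ fmap (re i) phi).
  move=> V psi; have [x ex] := re_iso_full (j := i) (inv (pb r' V) ∘ psi).
  have [u [e1 e2]] := op _ x; exists u; split.
    by rewrite (comp_tail (pb_nat _ _)); assoc_r; rewrite -fmap_comp e1 ex inv_r_tail.
  move=> u' e; apply: e2; apply: (re_iso_faithful (j := i)).
  rewrite ex -e (comp_tail (pb_nat _ _)); assoc_r.
  by rewrite inv_l_tail -fmap_comp.
set phi' := _ ∘ fmap _ _ in opki *; clearbody phi'.
(* Then change the target: test objects V in the fibre over Y are all of the form j^* W. *)
move=> V psi; pose w := re_retract (iso_sym j) V.
have [v [e1 e2]] := opki _ (pb r _ ∘ (fmap (re f) (inv w) ∘ psi)).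
have step (u : re j D ~> re (iso_sym (iso_sym j)) (re (iso_sym j) V)) v' :
    fmap (re j) v' = u ->
    fmap (re f) (w ∘ u) ∘ (inv (pb r D) ∘ phi') = psi <->
    fmap (re y) v' ∘ phi' = pb r _ ∘ (fmap (re f) (inv w) ∘ psi).
  move=> <-; rewrite fmap_comp.
  have n := pb_nat r v'.
  have -> : fmap (re y) v' = pb r _ ∘ fmap (re f) (fmap (re j) v') ∘ inv (pb r D).
    by rewrite -n -comp_assoc inv_r comp_id_r.
  assoc_r; split.
    by move=> <-; rewrite (comp_tail (eq_sym (fmap_comp _ _ _))) inv_l fmap_id comp_id_l.
  move=> e; have := iso_monic e => ->.
  by rewrite (comp_tail (eq_sym (fmap_comp _ _ _))) inv_r fmap_id comp_id_l.
exists (w ∘ fmap (re j) v); split; first exact/(step _ v).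
move=> u' e; have [v' ev'] := re_iso_full (j := j) (inv w ∘ u').
rewrite -(e2 v') ?ev' ?inv_r_tail //; apply/step; first exact: ev'.
by rewrite inv_r_tail.
Qed.

Section Coproducts.
Context (H : IndexedHomotopyCoproducts C).

(** The projection formula: its comparison map is the mate of the map displayed here when
    [phi] is the unit of the adjunction. *)
Lemma opc_tensor (X Z : S) (q : X ~> Z) (E : C X) (D : C Z) (phi : E ~> re q D) (R : C Z) :
  Opcartesian phi -> Opcartesian (fmul (re q) R D ∘ (idm (re q R) ⊗h phi)).
Proof.
move=> op; have [m ->] := opc_is_unit (push H q) op.
have opu : Opcartesian (fmul (re q) R _ ∘ (idm (re q R) ⊗h adj_unit (push H q) E)).
  apply: (opc_of_mate (L := push H q)); rewrite fmap_comp comp_assoc.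
  exact: projection_formula.
congr (Opcartesian _): (opc_post (iso_fmap2 tensor (iso_id R) m) opu); rewrite /=.
by rewrite (comp_tail (fmul_nat _ _ _)); assoc_r; rewrite fmap2_comp fmap_id comp_id_l.
Qed.

(** The Beck-Chevalley map is the mate of the reindexed unit of the adjunction. *)
Lemma exact_ho_pullback (X Y Z W : S) (f : X ~> Y) (h : X ~> Z) (g : Y ~> W) (k : Z ~> W) :
  ho_pullback H f h g k -> ExactSquare f h g k.
Proof.
move=> p E D phi op y r r'; have [m ->] := opc_is_unit (push H k) op.
have opu : Opcartesian (re_square (ho_pullback_comm p) (push H k E)
                        ∘ fmap (re h) (adj_unit (push H k) E)).
  apply: (opc_of_mate (L := push H f)); rewrite fmap_comp comp_assoc.
  exact: beck_chevalley.
congr (Opcartesian _): (opc_post (iso_fmap (re g) m) opu); rewrite /=.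
rewrite (re_squareE _ r r'); assoc_r; apply: (iso_monic (i := pb r D)).
by rewrite inv_r_tail fmap_comp !(comp_tail (eq_sym (pb_nat _ _))); assoc_r; rewrite inv_r_tail.
Qed.
End Coproducts.

End Opcartesian.

Arguments opc_unit {S C X Z q} L E.

(** * Maps into finite products *)

Section Products.
Context (S : CatWithFiniteProducts).

Lemma pair_ext (X A B : S) (f g : X ~> A × B) :
  pr1 ∘ f = pr1 ∘ g -> pr2 ∘ f = pr2 ∘ g -> f = g.
Proof. by move=> e1 e2; rewrite -(pair_uniq f) -(pair_uniq g) e1 e2. Qed.

Lemma pair_comp (X Y A B : S) (f : X ~> A) (g : X ~> B) (h : Y ~> X) :
  pairing f g ∘ h = pairing (f ∘ h) (g ∘ h).
Proof.
by apply: pair_ext; rewrite comp_assoc !(pr1_pair, pr2_pair).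
Qed.

Lemma pr1_pair_tail (X Y A B : S) (f : X ~> A) (g : X ~> B) (h : Y ~> X) :
  pr1 ∘ (pairing f g ∘ h) = f ∘ h.
Proof. by rewrite comp_assoc pr1_pair. Qed.

Lemma pr2_pair_tail (X Y A B : S) (f : X ~> A) (g : X ~> B) (h : Y ~> X) :
  pr2 ∘ (pairing f g ∘ h) = g ∘ h.
Proof. by rewrite comp_assoc pr2_pair. Qed.
End Products.

Ltac prod_simpl :=
  rewrite ?/contract_mid ?/diag_mid ?/passoc ?/passoc_inv ?/prunit ?/plunit ?/prod_map ?/diag;
  repeat progress rewrite ?pair_comp -?comp_assoc ?pr1_pair_tail ?pr2_pair_tail
    ?pr1_pair ?pr2_pair ?comp_id_l ?comp_id_r.
Ltac prod_eq := prod_simpl; repeat (f_equal; try exact: star_uniq).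

(** * Contexts of variables *)

Section Contexts.
Context (S : CatWithFiniteProducts).

(** A presheaf of sets on S with a chosen representation: [gen] is the universal point and
    [name] the map classifying a point.  Keeping the presheaf, rather than only the
    representing object, makes projections of tuples of variables compute. *)
Record Ctx := {
  cob : S;
  pts : S -> Type;
  act : forall X Y : S, Y ~> X -> pts X -> pts Y;
  gen : pts cob;
  name : forall X : S, pts X -> X ~> cob;
  act_name : forall (X : S) (g : pts X), act (name g) gen = g;
  name_act : forall (X Y : S) (h : Y ~> X) (g : pts X), name (act h g) = name g ∘ h;
  name_gen : name gen = idm cob
}.
Arguments act {c X Y} h g : rename.
Arguments gen {c} : rename.
Arguments name {c X} g : rename.

Lemma name_inj (G : Ctx) (X : S) (g g' : pts G X) : name g = name g' -> g = g'.
Proof. by move=> e; rewrite -(act_name g) e act_name. Qed.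

Lemma act_comp (G : Ctx) (X Y Z : S) (h : Y ~> X) (k : Z ~> Y) (g : pts G X) :
  act k (act h g) = act (h ∘ k) g.
Proof. by apply: name_inj; rewrite !name_act comp_assoc. Qed.

Definition cvar (A : S) : Ctx.
Proof.
refine {| cob := A; pts := fun X => X ~> A; act := fun X Y h f => f ∘ h; gen := idm A;
          name := fun X f => f |}.
- abstract (by move=> X g; exact: comp_id_l).
- abstract (by []).
- abstract (by []).
Defined.

Definition cnil : Ctx.
Proof.
refine {| cob := star; pts := fun X => unit; act := fun X Y h g => g; gen := tt;
          name := fun X _ => proj X |}.
- abstract (by move=> X []).
- abstract (by move=> X Y h _; exact: star_uniq).
- abstract (exact: star_uniq).
Defined.

Definition cext (G : Ctx) (B : S) : Ctx.
Proof.
refine {| cob := cob G × B; pts := fun X => (pts G X * (X ~> B))%type;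
          act := fun X Y h g => (act h (fst g), snd g ∘ h);
          gen := (act pr1 gen, pr2);
          name := fun X g => pairing (name (fst g)) (snd g) |}.
- abstract (by move=> X [g b] /=; rewrite act_comp pr1_pair pr2_pair act_name).
- abstract (by move=> X Y h [g b] /=; rewrite name_act pair_comp).
- abstract (by rewrite /= name_act name_gen -[RHS]pair_uniq comp_id_l !comp_id_r).
Defined.

Record CMap (G G' : Ctx) := {
  cm : forall X : S, pts G X -> pts G' X;
  cm_act : forall (X Y : S) (h : Y ~> X) (g : pts G X), cm (act h g) = act h (cm g)
}.
Local Notation "c ⋅ g" := (cm c g) (at level 30).

Definition cid (G : Ctx) : CMap G G.
Proof. exists (fun X g => g); abstract by [].
Defined.

Definition ccomp (G G' G'' : Ctx) (t : CMap G' G'') (s : CMap G G') : CMap G G''.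
Proof. exists (fun X g => t ⋅ (s ⋅ g)); abstract (by move=> X Y h g; rewrite !cm_act). Defined.

Definition cfst (G : Ctx) (B : S) : CMap (cext G B) G.
Proof. exists (fun X g => fst g); abstract by [].
Defined.

Definition csnd (G : Ctx) (B : S) : CMap (cext G B) (cvar B).
Proof. exists (fun X g => snd g); abstract by [].
Defined.

(** Substitution of [b] for the last variable. *)
Definition cgraph (G : Ctx) (B : S) (b : CMap G (cvar B)) : CMap G (cext G B).
Proof. exists (fun X g => (g, b ⋅ g)); abstract (by move=> X Y h g; rewrite cm_act). Defined.

Definition cpair (G : Ctx) (A B : S) (a : CMap G (cvar A)) (b : CMap G (cvar B)) :
  CMap G (cvar (A × B)).
Proof.
exists (fun X g => pairing (a ⋅ g : X ~> A) (b ⋅ g : X ~> B));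
  abstract (by move=> X Y h g; rewrite !cm_act /= pair_comp).
Defined.

Definition cto_nil (G : Ctx) : CMap G cnil.
Proof. exists (fun X _ => tt); abstract by [].
Defined.

Definition cproj (G : Ctx) : CMap G (cvar star).
Proof. exists (fun X _ => proj X); abstract (by move=> X Y h g; exact: star_uniq). Defined.

End Contexts.

Arguments act {S c X Y} h g : rename.
Arguments gen {S c} : rename.
Arguments name {S c X} g : rename.
Notation "c ⋅ g" := (cm c g) (at level 30).

(** * Families of objects over a context *)

Section Families.
Context (S : CatWithFiniteProducts) (C : IndexedSymMonCat S).

(** A family is a pseudonatural assignment of fibre objects to points.  The relation [Rel]
    says that [g'] is the reindexing of [g] as far as the family can see; having it as data
    lets families that differ only in proofs about their indexing agree by computation. *)
Record Fam (G : Ctx S) := {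
  fob : forall X : S, pts G X -> C X;
  Rel : forall X Y : S, Y ~> X -> pts G X -> pts G Y -> Prop;
  rel_act : forall (X Y : S) (h : Y ~> X) (g : pts G X) (g' : pts G Y), act h g = g' -> Rel h g g';
  fre : forall (X Y : S) (h : Y ~> X) (g : pts G X) (g' : pts G Y),
    Rel h g g' -> Iso (re h (fob g)) (fob g');
  fre_id : forall (X : S) (g : pts G X) (r : Rel (idm X) g g),
    fre r ∘ re_id (fob g) = idm (fob g);
  fre_comp : forall (X Y Z : S) (h : Y ~> X) (k : Z ~> Y) (n : Z ~> X)
      (g : pts G X) (g' : pts G Y) (g'' : pts G Z)
      (en : h ∘ k = n) (r : Rel h g g') (r' : Rel k g' g'') (r'' : Rel n g g''),
    fre r' ∘ fmap (re k) (fre r) = fre r'' ∘ pb en (fob g)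
}.
Arguments fob {G} f {X} g : rename.
Arguments Rel {G} f {X Y} h g g' : rename.
Arguments fre {G} f {X Y h g g'} r : rename.
Arguments rel_act {G} f {X Y h g g'} e : rename.

(** The object [N] with the generalized element [x] substituted for its variable. *)
Definition fatom (G : Ctx S) (Z : S) (N : C Z) (x : CMap G (cvar Z)) : Fam G.
Proof.
refine {| fob := fun X g => re (x ⋅ g : X ~> Z) N;
          Rel := fun X Y h g g' => (x ⋅ g : X ~> Z) ∘ h = x ⋅ g';
          fre := fun X Y h g g' r => pb r N |}.
- abstract (by move=> X Y h g g' <-; rewrite cm_act).
- abstract (by move=> X g r; exact: pb_id).
- abstract (by move=> *; exact: pb_comp).
Defined.

Definition fone_fam (G : Ctx S) : Fam G.
Proof.
refine {| fob := fun X g => munit; Rel := fun X Y h g g' => True;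
          fre := fun X Y h g g' r => iso_sym (fone (re h)) |}.
- abstract (by []).
- abstract (by move=> X g _ /=; rewrite re_id_one inv_l).
- abstract (
    move=> X Y Z h k n g g' g'' en _ _ _ /=;
    apply: (iso_monic (i := fone (re n))); rewrite inv_r_tail -(pb_one C en); assoc_r;
    by rewrite inv_r_tail -fmap_comp inv_r fmap_id comp_id_r).
Defined.

Definition ften (G : Ctx S) (F F' : Fam G) : Fam G.
Proof.
refine {| fob := fun X g => fob F g ⊗ fob F' g;
          Rel := fun X Y h g g' => Rel F h g g' /\ Rel F' h g g';
          fre := fun X Y h g g' r =>
            iso_comp (iso_fmap2 tensor (fre F (let: conj p _ := r in p))
                                       (fre F' (let: conj _ p := r in p)))
                     (iso_sym (fmul (re h) (fob F g) (fob F' g))) |}.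
- abstract (by move=> X Y h g g' e; split; exact: rel_act).
- abstract (
    move=> X g [r r']; rewrite iso_compE /= re_id_mul -comp_assoc inv_l_tail;
    by rewrite fmap2_comp !fre_id fmap2_id).
- abstract (
    move=> X Y Z h k n g g' g'' en [r1 s1] [r2 s2] [r3 s3];
    rewrite !iso_compE /= fmap_comp; assoc_r;
    apply: (iso_epic (i := iso_fmap (re k) (fmul (re h) (fob F g) (fob F' g))));
    rewrite /=; assoc_r; rewrite -fmap_comp inv_l fmap_id comp_id_r;
    apply: (iso_epic (i := fmul (re k) (re h (fob F g)) (re h (fob F' g))));
    assoc_r; rewrite pb_mul inv_l_tail fmul_nat inv_l_tail !fmap2_comp;
    by rewrite (fre_comp en r1 r2 r3) (fre_comp en s1 s2 s3)).
Defined.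

Definition fpull (G G' : Ctx S) (s : CMap G G') (F : Fam G') : Fam G.
Proof.
refine {| fob := fun X g => fob F (s ⋅ g);
          Rel := fun X Y h g g' => Rel F h (s ⋅ g) (s ⋅ g');
          fre := fun X Y h g g' r => fre F r |}.
- abstract (by move=> X Y h g g' <-; apply: rel_act; rewrite cm_act).
- abstract (by move=> X g r; exact: fre_id).
- abstract (by move=> X Y Z h k n g g' g'' en r r' r''; exact: fre_comp).
Defined.

Definition Nat (G : Ctx S) (F F' : Fam G)
    (u : forall (X : S) (g : pts G X), fob F g ~> fob F' g) : Prop :=
  forall (X Y : S) (h : Y ~> X) (g : pts G X) (g' : pts G Y)
    (e : act h g = g') (r : Rel F h g g') (r' : Rel F' h g g'),
    fre F' r' ∘ fmap (re h) (u X g) = u Y g' ∘ fre F r.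

Lemma nat_comp (G : Ctx S) (F F' F'' : Fam G)
    (v : forall (X : S) (g : pts G X), fob F' g ~> fob F'' g)
    (u : forall (X : S) (g : pts G X), fob F g ~> fob F' g) :
  Nat v -> Nat u -> Nat (fun X g => v X g ∘ u X g).
Proof.
move=> nv nu X Y h g g' e r r'; have s : Rel F' h g g' by exact: rel_act.
by rewrite fmap_comp comp_assoc (nv _ _ _ _ _ e s) -comp_assoc (nu _ _ _ _ _ e r s) comp_assoc.
Qed.

Lemma nat_id (G : Ctx S) (F : Fam G) : @Nat G F F (fun X g => idm (fob F g)).
Proof.
move=> X Y h g g' e r r'; rewrite fmap_id comp_id_l comp_id_r.
by rewrite (proof_irrelevance _ r r').
Qed.

Lemma nat_inv (G : Ctx S) (F F' : Fam G)
    (u : forall (X : S) (g : pts G X), Iso (fob F g) (fob F' g)) :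
  @Nat G F F' (fun X g => u X g) -> @Nat G F' F (fun X g => inv (u X g)).
Proof.
move=> n X Y h g g' e r r'; apply: (iso_monic (i := u Y g')); rewrite inv_r_tail.
rewrite comp_assoc -(n _ _ _ _ _ e r' r) -comp_assoc -fmap_comp inv_r fmap_id.
by rewrite comp_id_r.
Qed.

Lemma nat_ten (G : Ctx S) (F1 F1' F2 F2' : Fam G)
    (u : forall (X : S) (g : pts G X), fob F1 g ~> fob F1' g)
    (v : forall (X : S) (g : pts G X), fob F2 g ~> fob F2' g) :
  Nat u -> Nat v -> @Nat G (ften F1 F2) (ften F1' F2') (fun X g => u X g ⊗h v X g).
Proof.
move=> nu nv X Y h g g' e [r1 r2] [r1' r2'] /=; rewrite !iso_compE /=.
apply: (iso_epic (i := fmul (re h) (fob F1 g) (fob F2 g))).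
assoc_r; rewrite inv_l comp_id_r fmul_nat inv_l_tail !fmap2_comp.
by rewrite (nu _ _ _ _ _ e r1) (nv _ _ _ _ _ e r2).
Qed.

Lemma nat_massoc (G : Ctx S) (F1 F2 F3 : Fam G) :
  @Nat G (ften (ften F1 F2) F3) (ften F1 (ften F2 F3))
    (fun X g => massoc (fob F1 g) (fob F2 g) (fob F3 g)).
Proof.
move=> X Y h g g' e [[r1 r2] r3] [s1 [s2 s3]] /=; rewrite !iso_compE /= !iso_compE /=.
rewrite (proof_irrelevance _ s1 r1) (proof_irrelevance _ s2 r2) (proof_irrelevance _ s3 r3).
apply: (iso_epic (i := fmul (re h) (fob F1 g ⊗ fob F2 g) (fob F3 g))).
apply: (iso_epic (i := iso_fmap2 tensor (fmul (re h) (fob F1 g) (fob F2 g)) (iso_id _))).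
have e1 := fmul_assoc (re h) (fob F1 g) (fob F2 g) (fob F3 g).
rewrite -!comp_assoc /= in e1 *; rewrite e1 inv_l_tail inv_l_tail.
rewrite (comp_tail (fmap2_comp _ _ _ _ _)) fmap2_comp comp_id_r.
by rewrite -!comp_assoc !inv_l !comp_id_r -massoc_nat.
Qed.

Lemma nat_mlunit (G : Ctx S) (F : Fam G) :
  @Nat G (ften (fone_fam G) F) F (fun X g => mlunit (fob F g)).
Proof.
move=> X Y h g g' e [r1 r2] r /=; rewrite !iso_compE /=.
rewrite (proof_irrelevance _ r2 r).
apply: (iso_epic (i := fmul (re h) munit (fob F g))).
apply: (iso_epic (i := iso_fmap2 tensor (fone (re h)) (iso_id _))).
have e1 := fmul_lunit (re h) (fob F g).
rewrite -!comp_assoc /= in e1 *; rewrite e1 inv_l_tail mlunit_nat.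
by rewrite fmap2_comp inv_l comp_id_r.
Qed.

Lemma nat_mrunit (G : Ctx S) (F : Fam G) :
  @Nat G (ften F (fone_fam G)) F (fun X g => mrunit (fob F g)).
Proof.
move=> X Y h g g' e [r1 r2] r /=; rewrite !iso_compE /=.
rewrite (proof_irrelevance _ r1 r).
apply: (iso_epic (i := fmul (re h) (fob F g) munit)).
apply: (iso_epic (i := iso_fmap2 tensor (iso_id _) (fone (re h)))).
have e1 := fmul_runit (re h) (fob F g).
rewrite -!comp_assoc /= in e1 *; rewrite e1 inv_l_tail mrunit_nat.
by rewrite fmap2_comp inv_l comp_id_r.
Qed.

Lemma nat_msym (G : Ctx S) (F F' : Fam G) :
  @Nat G (ften F F') (ften F' F) (fun X g => msym (fob F g) (fob F' g)).
Proof.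
move=> X Y h g g' e [r1 r2] [s1 s2] /=; rewrite !iso_compE /=.
rewrite (proof_irrelevance _ s1 r2) (proof_irrelevance _ s2 r1).
apply: (iso_epic (i := fmul (re h) (fob F g) (fob F' g))).
by assoc_r; rewrite inv_l comp_id_r fmul_sym inv_l_tail msym_nat.
Qed.

Lemma nat_fatom (G : Ctx S) (Z : S) (N N' : C Z) (x : CMap G (cvar Z)) (u : N ~> N') :
  @Nat G (fatom N x) (fatom N' x) (fun X g => fmap (re (x ⋅ g : X ~> Z)) u).
Proof.
move=> X Y h g g' e r r' /=; rewrite -pb_nat.
by rewrite (proof_irrelevance _ r r').
Qed.

Lemma nat_fmul (G : Ctx S) (Z : S) (N N' : C Z) (x : CMap G (cvar Z)) :
  @Nat G (ften (fatom N x) (fatom N' x)) (fatom (N ⊗ N') x)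
     (fun X g => fmul (re (x ⋅ g : X ~> Z)) N N').
Proof.
move=> X Y h g g' e [r1 r2] r /=; rewrite !iso_compE /=.
rewrite (proof_irrelevance _ r1 r) (proof_irrelevance _ r2 r).
apply: (iso_epic (i := fmul (re h) (re (x ⋅ g : X ~> Z) N) (re (x ⋅ g : X ~> Z) N'))).
by assoc_r; rewrite inv_l comp_id_r pb_mul.
Qed.

Lemma nat_fone (G : Ctx S) (Z : S) (x : CMap G (cvar Z)) :
  @Nat G (fone_fam G) (fatom munit x) (fun X g => fone (re (x ⋅ g : X ~> Z))).
Proof.
move=> X Y h g g' e _ r /=.
apply: (iso_epic (i := fone (re h))).
by assoc_r; rewrite inv_l comp_id_r pb_one.
Qed.

(** A map over [k] acts on generalized elements: from E at [x] to D at [k ∘ x], the latter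
    being written [y]. *)
Definition inst (X Z W : S) (k : Z ~> W) (x : X ~> Z) (y : X ~> W) (e : k ∘ x = y)
    (E : C Z) (D : C W) (phi : E ~> re k D) : re x E ~> re y D :=
  pb e D ∘ fmap (re x) phi.

Lemma nat_inst (G : Ctx S) (Z W : S) (k : Z ~> W) (x : CMap G (cvar Z)) (y : CMap G (cvar W))
    (e : forall (X : S) (g : pts G X), k ∘ (x ⋅ g : X ~> Z) = y ⋅ g)
    (E : C Z) (D : C W) (phi : E ~> re k D) :
  @Nat G (fatom E x) (fatom D y) (fun X g => inst (e X g) phi).
Proof.
move=> X Y h g g' eg r r' /=; rewrite /inst fmap_comp comp_assoc.
by rewrite (pb_comp r (e X g) r' (e Y g')) -!comp_assoc pb_nat.
Qed.

Lemma nat_pb (G : Ctx S) (Z W : S) (k : Z ~> W) (x : CMap G (cvar Z)) (y : CMap G (cvar W))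
    (e : forall (X : S) (g : pts G X), k ∘ (x ⋅ g : X ~> Z) = y ⋅ g) (D : C W) :
  @Nat G (fatom (re k D) x) (fatom D y) (fun X g => pb (e X g) D).
Proof. by move=> X Y h g g' eg r r'; exact: pb_comp. Qed.

Lemma nat_pull (G G' : Ctx S) (s : CMap G G') (F F' : Fam G')
    (u : forall (X : S) (g : pts G' X), fob F g ~> fob F' g) :
  Nat u -> @Nat G (fpull s F) (fpull s F') (fun X g => u X (s ⋅ g)).
Proof. by move=> n X Y h g g' <- r r'; apply: n; rewrite cm_act. Qed.

(** The Yoneda lemma for families: every point is a reindexing of the generic one, so that
    natural maps are determined by their generic value, and, by [nat_spread], any generic
    value extends. *)
Lemma nat_ext (G : Ctx S) (F F' : Fam G)
    (u v : forall (X : S) (g : pts G X), fob F g ~> fob F' g) :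
  Nat u -> Nat v -> u _ gen = v _ gen -> forall (X : S) (g : pts G X), u X g = v X g.
Proof.
move=> nu nv e X g; have eg := act_name g.
have r : Rel F (name g) gen g by exact: rel_act.
have r' : Rel F' (name g) gen g by exact: rel_act.
by apply: (iso_epic (i := fre F r)); rewrite -(nu _ _ _ _ _ eg r r') e (nv _ _ _ _ _ eg r r').
Qed.

Lemma nat_spread (G : Ctx S) (F F' : Fam G) (w : fob F (gen (c := G)) ~> fob F' (gen (c := G))) :
  exists u : forall (X : S) (g : pts G X), fob F g ~> fob F' g, Nat u /\ u _ gen = w.
Proof.
pose u X (g : pts G X) : fob F g ~> fob F' g :=
  fre F' (rel_act F' (act_name g)) ∘ fmap (re (name g)) w ∘ inv (fre F (rel_act F (act_name g))).
exists u; split; last first.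
  rewrite /u; move: (rel_act F' _) (rel_act F _); rewrite name_gen => r r'.
  apply: (iso_epic (i := fre F r')); rewrite -comp_assoc inv_l comp_id_r.
  apply: (iso_epic (i := re_id (fob F gen))); rewrite -!comp_assoc fre_id re_id_nat comp_id_r.
  by rewrite comp_assoc fre_id comp_id_l.
move=> X Y h g g' e r r'; rewrite /u.
have en : name g ∘ h = name g' by rewrite -e name_act.
move: (rel_act F' (act_name g)) (rel_act F (act_name g)) => r1 r1'.
move: (rel_act F' (act_name g')) (rel_act F (act_name g')) => r2 r2'.
rewrite !fmap_comp !comp_assoc (fre_comp en r1 r' r2).
apply: (iso_epic (i := iso_fmap (re h) (fre F r1'))); rewrite /= -!comp_assoc.
rewrite -fmap_comp inv_l fmap_id comp_id_r.
by rewrite (fre_comp en r1' r r2') inv_l_tail pb_nat.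
Qed.

(** When [y] names the generic element itself, reindexing along its generic value is
    isomorphic to the identity, and natural maps between atoms are maps of the fibre. *)
Lemma nat_lower (G : Ctx S) (y : CMap G (cvar (cob G))) (N N' : C (cob G))
    (u : forall (X : S) (g : pts G X), re (y ⋅ g : X ~> cob G) N ~> re (y ⋅ g : X ~> cob G) N') :
  y ⋅ gen = idm (cob G) -> @Nat G (fatom N y) (fatom N' y) u ->
  exists f : N ~> N', forall (X : S) (g : pts G X), fmap (re (y ⋅ g : X ~> cob G)) f = u X g.
Proof.
move=> ey nu; have [f ef] : exists f : N ~> N', fmap (re (y ⋅ gen : _ ~> cob G)) f = u _ gen.
  move: (u _ gen); rewrite ey => w.
  exists (inv (re_id N') ∘ w ∘ re_id N); apply: (iso_epic (i := re_id N)).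
  by rewrite re_id_nat -comp_assoc inv_r_tail.
exists f; exact: (nat_ext (@nat_fatom G _ N N' y f) nu).
Qed.

Lemma re_gen_faithful (G : Ctx S) (y : CMap G (cvar (cob G))) (N N' : C (cob G)) (f f' : N ~> N') :
  y ⋅ gen = idm (cob G) ->
  fmap (re (y ⋅ gen : _ ~> cob G)) f = fmap (re (y ⋅ gen : _ ~> cob G)) f' -> f = f'.
Proof.
move=> -> e; apply: (iso_monic (i := re_id N')).
by rewrite -!re_id_nat e.
Qed.
End Families.

Arguments fob {S C G} f {X} g : rename.
Arguments Rel {S C G} f {X Y} h g g' : rename.
Arguments fre {S C G} f {X Y h g g'} r : rename.
Arguments rel_act {S C G} f {X Y h g g'} e : rename.

(** * Universal families *)

(** These tactics compare families only through their components: the proofs stored in the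
    families need not be convertible. *)
Ltac exact_nat n :=
  let X := fresh in let Y := fresh in let h := fresh in let g := fresh in
  let g' := fresh in let e := fresh in let r := fresh in let r' := fresh in
  intros X Y h g g' e r r'; exact (n X Y h g g' e r r').

Ltac exact_universal u :=
  split; [exact_nat (proj1 u)
         | let q := fresh in let r := fresh in let e := fresh in
           intros q r e; exact (proj2 u q r e)].

Section Universal.
Context (S : CatWithFiniteProducts) (C : IndexedSymMonCat S).

(** Natural maps [phi] over a substitution [s] which are opcartesian at the generic point,
    over the map [name (s ⋅ gen)] representing [s].  Naturality propagates the universal
    property from there to all points: see [univ_uniq] and [univ_factor]. *)
Definition Universal (G0 G : Ctx S) (s : CMap G0 G) (E : Fam C G0) (D : Fam C G)
    (phi : forall (X : S) (g : pts G0 X), fob E g ~> fob D (s ⋅ g)) : Prop :=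
  @Nat S C G0 E (fpull s D) phi /\
  forall (q : cob G0 ~> cob G) (r : Rel D q gen (s ⋅ gen)), name (s ⋅ gen) = q ->
    Opcartesian (inv (fre D r) ∘ phi _ gen).

Arguments nat_pull {S C G G'} s {F F' u} _.

Section Factor.
Context (G0 G : Ctx S) (s : CMap G0 G) (E : Fam C G0) (D : Fam C G).
Context (phi : forall (X : S) (g : pts G0 X), fob E g ~> fob D (s ⋅ g)).
Arguments phi : clear implicits.
Context (univ : Universal phi).

Lemma univ_uniq (W : Fam C G) (u v : forall (X : S) (g : pts G X), fob D g ~> fob W g) :
  Nat u -> Nat v ->
  (forall (X : S) (g : pts G0 X), u X (s ⋅ g) ∘ phi X g = v X (s ⋅ g) ∘ phi X g) ->
  forall (X : S) (g : pts G X), u X g = v X g.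
Proof.
move=> nu nv e; apply: (nat_ext nu nv).
have eg := act_name (s ⋅ gen (c := G0)).
have r : Rel D (name (s ⋅ gen)) gen (s ⋅ gen (c := G0)) by exact: rel_act.
have r' : Rel W (name (s ⋅ gen)) gen (s ⋅ gen (c := G0)) by exact: rel_act.
have [w [_ ew]] := proj2 univ _ r eq_refl _ (inv (fre W r') ∘ (u _ (s ⋅ gen) ∘ phi _ gen)).
transitivity w; last symmetry; apply: ew;
  apply: (iso_monic (i := fre W r')); rewrite inv_r_tail.
  by rewrite (comp_tail (nu _ _ _ _ _ eg r r')); assoc_r; rewrite inv_r_tail.
by rewrite e (comp_tail (nv _ _ _ _ _ eg r r')); assoc_r; rewrite inv_r_tail.
Qed.

Lemma univ_factor (W : Fam C G) (t : forall (X : S) (g : pts G0 X), fob E g ~> fob W (s ⋅ g)) :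
  @Nat S C G0 E (fpull s W) t ->
  exists u : forall (X : S) (g : pts G X), fob D g ~> fob W g,
    Nat u /\ forall (X : S) (g : pts G0 X), u X (s ⋅ g) ∘ phi X g = t X g.
Proof.
move=> nt; have eg := act_name (s ⋅ gen (c := G0)).
have r : Rel D (name (s ⋅ gen)) gen (s ⋅ gen (c := G0)) by exact: rel_act.
have r' : Rel W (name (s ⋅ gen)) gen (s ⋅ gen (c := G0)) by exact: rel_act.
have [w [ew _]] := proj2 univ _ r eq_refl _ (inv (fre W r') ∘ t _ gen).
have [u [nu eu]] := nat_spread w; exists u; split; first by [].
have n1 : @Nat S C G0 E (fpull s W) (fun X g => u X (s ⋅ g) ∘ phi X g).
  exact: (@nat_comp S C G0 E (fpull s D) (fpull s W) (fun X g => u X (s ⋅ g)) phi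
    (nat_pull s nu) (proj1 univ)).
apply: (nat_ext n1 nt); apply: (inv_monic (i := fre W r')); rewrite -ew.
apply: (iso_monic (i := fre W r')); rewrite inv_r_tail.
rewrite -eu (comp_tail (nu _ _ _ _ _ eg r r')); assoc_r.
by rewrite inv_r_tail.
Qed.
End Factor.

(** The form used for 2-cells: on the full context of variables of D, natural maps out of D
    are maps of the fibre. *)
Lemma univ_hom_ext (G0 G : Ctx S) (s : CMap G0 G) (y : CMap G (cvar (cob G))) (E : Fam C G0)
    (D W : C (cob G))
    (phi : forall (X : S) (g : pts G0 X), fob E g ~> re (y ⋅ (s ⋅ g) : X ~> cob G) D)
    (f f' : D ~> W) :
  y ⋅ gen = idm (cob G) -> Universal (D := fatom D y) phi ->
  (forall (X : S) (g : pts G0 X),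
     fmap (re (y ⋅ (s ⋅ g) : X ~> cob G)) f ∘ phi X g
     = fmap (re (y ⋅ (s ⋅ g) : X ~> cob G)) f' ∘ phi X g) ->
  f = f'.
Proof.
move=> ey univ e; apply: (re_gen_faithful ey).
have n1 := @nat_fatom S C G _ D W y f.
have n2 := @nat_fatom S C G _ D W y f'.
exact: (univ_uniq univ n1 n2 e).
Qed.

Lemma univ_hom_factor (G0 G : Ctx S) (s : CMap G0 G) (y : CMap G (cvar (cob G))) (E : Fam C G0)
    (D W : C (cob G))
    (phi : forall (X : S) (g : pts G0 X), fob E g ~> re (y ⋅ (s ⋅ g) : X ~> cob G) D)
    (t : forall (X : S) (g : pts G0 X), fob E g ~> re (y ⋅ (s ⋅ g) : X ~> cob G) W) :
  y ⋅ gen = idm (cob G) -> Universal (D := fatom D y) phi ->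
  @Nat S C G0 E (fpull s (fatom W y)) t ->
  exists f : D ~> W, forall (X : S) (g : pts G0 X),
    fmap (re (y ⋅ (s ⋅ g) : X ~> cob G)) f ∘ phi X g = t X g.
Proof.
move=> ey univ nt; have [u [nu eu]] := univ_factor univ (W := fatom W y) nt.
by have [f ef] := nat_lower ey nu; exists f => X g; rewrite ef eu.
Qed.

(** Because opcartesian maps compose, variables can be eliminated one at a time. *)
Lemma univ_comp (G1 G0 G : Ctx S) (t : CMap G1 G0) (s : CMap G0 G)
    (E' : Fam C G1) (E : Fam C G0) (D : Fam C G)
    (chi : forall (X : S) (g : pts G1 X), fob E' g ~> fob E (t ⋅ g))
    (phi : forall (X : S) (g : pts G0 X), fob E g ~> fob D (s ⋅ g)) :
  Universal chi -> Universal phi ->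
  @Universal G1 G (ccomp s t) E' D (fun X g => phi X (t ⋅ g) ∘ chi X g).
Proof.
move=> [n1 u1] [n2 u2]; split; first exact: (@nat_comp S C G1 E' (fpull t E) (fpull (ccomp s t) D)
    (fun X g => phi X (t ⋅ g)) chi (nat_pull t n2) n1).
move=> q r eq; pose e := act_name (t ⋅ gen (c := G1)).
have es : act (name (t ⋅ gen (c := G1))) (s ⋅ gen) = s ⋅ (t ⋅ gen).
  by rewrite -cm_act e.
have rE : Rel E (name (t ⋅ gen)) gen (t ⋅ gen (c := G1)) by exact: rel_act.
have rD : Rel D (name (s ⋅ gen)) gen (s ⋅ gen (c := G0)) by apply: rel_act; exact: act_name.
have rD' : Rel D (name (t ⋅ gen)) (s ⋅ gen) (s ⋅ (t ⋅ gen (c := G1))) by exact: rel_act.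
have eqs : name (s ⋅ gen) ∘ name (t ⋅ gen) = q by rewrite -eq /= -es name_act.
have op := opc_comp eqs (u1 _ rE eq_refl) (u2 _ rD eq_refl).
congr (Opcartesian _): op.
apply: (iso_monic (i := fre D r)); rewrite inv_r_tail.
rewrite (comp_tail (eq_sym (fre_comp eqs rD rD' r))) fmap_comp; assoc_r.
rewrite (comp_tail (eq_sym (fmap_comp _ _ _))) inv_r fmap_id comp_id_l.
by rewrite (comp_tail (n2 _ _ _ _ _ e rE rD')); assoc_r; rewrite inv_r_tail.
Qed.

Lemma univ_conj (G0 G : Ctx S) (s : CMap G0 G) (E E' : Fam C G0) (D D' : Fam C G)
    (i : forall (X : S) (g : pts G0 X), Iso (fob E' g) (fob E g))
    (j : forall (X : S) (g : pts G X), Iso (fob D g) (fob D' g))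
    (phi : forall (X : S) (g : pts G0 X), fob E g ~> fob D (s ⋅ g)) :
  @Nat S C G0 E' E (fun X g => i X g) -> @Nat S C G D D' (fun X g => j X g) ->
  Universal phi ->
  @Universal G0 G s E' D' (fun X g => j X (s ⋅ g) ∘ (phi X g ∘ i X g)).
Proof.
move=> ni nj [n u]; split.
  exact: (@nat_comp S C G0 E' (fpull s D) (fpull s D') (fun X g => j X (s ⋅ g))
    (fun X g => phi X g ∘ i X g) (nat_pull s nj)
    (@nat_comp S C G0 E' E (fpull s D) phi (fun X g => i X g) n ni)).
move=> q r eq; have eg : act q gen = s ⋅ gen (c := G0) by rewrite -eq act_name.
have rD : Rel D q gen (s ⋅ gen (c := G0)) by exact: rel_act.
have op := opc_post (j _ gen) (opc_pre (i _ gen) (u _ rD eq)).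
congr (Opcartesian _): op.
apply: (iso_monic (i := fre D' r)); rewrite inv_r_tail.
by rewrite (comp_tail (nj _ _ _ _ _ eg rD r)); assoc_r; rewrite inv_r_tail.
Qed.

(** An opcartesian map over a fixed [k] is universal at all generalized elements for which
    the square with [k] is exact. *)
Lemma univ_inst (G0 G : Ctx S) (s : CMap G0 G) (Z W : S) (k : Z ~> W)
    (x : CMap G0 (cvar Z)) (y : CMap G (cvar W))
    (e : forall (X : S) (g : pts G0 X), k ∘ (x ⋅ g : X ~> Z) = y ⋅ (s ⋅ g))
    (E : C Z) (D : C W) (phi : E ~> re k D) :
  ExactSquare C (name (s ⋅ gen)) (x ⋅ gen : cob G0 ~> Z) (y ⋅ gen : cob G ~> W) k ->
  Opcartesian phi ->
  @Universal G0 G s (fatom E x) (fatom D y) (fun X g => inst (e X g) phi).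
Proof.
move=> ex op; split.
  exact: (@nat_inst S C G0 Z W k x (ccomp y s) e E D phi).
move=> q r eq; subst q; exact: (ex _ _ _ op _ r (e _ gen)).
Qed.

Lemma univ_ext (G0 G : Ctx S) (s : CMap G0 G) (E : Fam C G0) (D : Fam C G)
    (phi phi' : forall (X : S) (g : pts G0 X), fob E g ~> fob D (s ⋅ g)) :
  (forall (X : S) (g : pts G0 X), phi X g = phi' X g) -> Universal phi -> Universal phi'.
Proof.
move=> e [n u]; split; first by move=> X Y h g g' eg r r'; rewrite -!e; exact: n.
by move=> q r eq; rewrite -e; exact: u.
Qed.

Section TensorStable.
Context (H : IndexedHomotopyCoproducts C).

(** The projection formula at the generic point: [R] is a family over [G] because it must not
    involve the eliminated variable. *)
Lemma univ_ten_l (G0 G : Ctx S) (s : CMap G0 G) (E : Fam C G0) (D R : Fam C G)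
    (phi : forall (X : S) (g : pts G0 X), fob E g ~> fob D (s ⋅ g)) :
  Universal phi ->
  @Universal G0 G s (ften (fpull s R) E) (ften R D)
    (fun X g => idm (fob R (s ⋅ g)) ⊗h phi X g).
Proof.
move=> [n u]; split.
  exact: (@nat_ten S C G0 (fpull s R) (fpull s R) E (fpull s D)
    (fun X g => idm (fob R (s ⋅ g))) phi (@nat_id S C G0 (fpull s R)) n).
move=> q [rR rD] eq.
have op := opc_pre (iso_fmap2 tensor (iso_sym (fre R rR)) (iso_id (fob E gen)))
             (opc_tensor H (R := fob R gen) (u _ rD eq)).
congr (Opcartesian _): op; rewrite /= iso_comp_inv /=; assoc_r.
by rewrite !fmap2_comp !comp_id_l !comp_id_r.
Qed.

Lemma univ_ten_r (G0 G : Ctx S) (s : CMap G0 G) (E : Fam C G0) (D R : Fam C G)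
    (phi : forall (X : S) (g : pts G0 X), fob E g ~> fob D (s ⋅ g)) :
  Universal phi ->
  @Universal G0 G s (ften E (fpull s R)) (ften D R)
    (fun X g => phi X g ⊗h idm (fob R (s ⋅ g))).
Proof.
move=> univ.
have u := @univ_conj G0 G s (ften (fpull s R) E) (ften E (fpull s R)) (ften R D) (ften D R)
            (fun X g => msym (fob E g) (fob R (s ⋅ g)))
            (fun X g => msym (fob R g) (fob D g)) _
            (@nat_msym S C G0 E (fpull s R)) (@nat_msym S C G R D) (univ_ten_l R univ).
apply: univ_ext u => X g.
by rewrite msym_nat (comp_tail (msym_involutive _ _)) comp_id_l.
Qed.
End TensorStable.
End Universal.

(** * The universal maps of composition, units and the shadow *)

Section Cells.
Context (S : CatWithFiniteProducts) (C : IndexedSymMonCat S).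
Context (H : IndexedHomotopyCoproducts C).

Lemma exact_required (X Y Z W : S) (f : X ~> Y) (h : X ~> Z) (g : Y ~> W) (k : Z ~> W) :
  base_square f h g k -> ExactSquare C f h g k.
Proof.
by move=> b; apply: (exact_ho_pullback (H := H)); apply: ho_pullback_required; exact: req_base.
Qed.

Definition prod_star_iso (Z : S) : Iso Z (Z × star).
Proof.
refine {| iso_hom := pairing (idm Z) (proj Z); inv := prunit Z |}.
- by rewrite /prunit pr1_pair.
- by apply: pair_ext; prod_eq.
Defined.

Definition mid_last_iso (A B D : S) : Iso ((A × D) × B) (A × (B × D)).
Proof.
refine {| iso_hom := pairing (pr1 ∘ pr1) (pairing pr2 (pr2 ∘ pr1));
          inv := pairing (pairing pr1 (pr2 ∘ pr2)) (pr1 ∘ pr2) |}.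
- by repeat apply: pair_ext; prod_eq.
- by repeat apply: pair_ext; prod_eq.
Defined.

Definition swap_iso (A : S) : Iso (A × A) (A × A).
Proof.
refine {| iso_hom := pairing pr2 pr1; inv := pairing pr2 pr1 |}.
- by repeat apply: pair_ext; prod_eq.
- by repeat apply: pair_ext; prod_eq.
Defined.

(** Up to the isomorphisms exchanging B with D and removing the terminal object, this is the
    product of the maps (a,d) and B ~> 1, with (a,d) arbitrary. *)
Lemma exact_mid (Z A B D : S) (a : Z ~> A) (d : Z ~> D) :
  ExactSquare C (pr1 : Z × B ~> Z) (pairing (a ∘ pr1) (pairing pr2 (d ∘ pr1)))
    (pairing a d) (contract_mid A B D).
Proof.
pose z := pairing a d.
have s3 := exact_iso (C := C) (f := idm (A × D) ×h proj B) (i := mid_last_iso A B D)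
             (j := iso_sym (prod_star_iso (A × D))) (k := contract_mid A B D).
have s2 := exact_required (base_transpose (base_prod z (proj B))).
have s1 := exact_iso (C := C) (f := pr1) (i := iso_id (Z × B))
             (j := prod_star_iso Z) (k := idm Z ×h proj B).
have s21 := exact_paste _ _ s2 s1.
have s321 := exact_paste _ _ s3 (s21 _ _).
have e1 : pairing (a ∘ pr1) (pairing pr2 (d ∘ pr1))
  = mid_last_iso A B D ∘ ((z ×h idm B) ∘ iso_id (Z × B)).
  by rewrite /z /=; prod_eq.
have e2 : pairing a d
  = iso_sym (prod_star_iso (A × D)) ∘ ((z ×h idm star) ∘ prod_star_iso Z).
  by rewrite /z /=; prod_eq.
rewrite e1 e2; apply: s321.
- by rewrite /=; apply: pair_ext; prod_eq.
- by rewrite /=; apply: pair_ext; prod_eq.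
- by rewrite /=; apply: pair_ext; prod_eq.
- by rewrite /=; apply: pair_ext; prod_eq.
Qed.

(** The two graph squares substitute b for a variable b' in U(b,b') and in U(b',b); the second
    follows from the first because the diagonal is invariant under the swap. *)
Lemma exact_graph_l (Z B : S) (b : Z ~> B) :
  ExactSquare C (pairing (idm Z) b) b (pairing (b ∘ pr1) pr2) (diag B).
Proof.
have -> : pairing (b ∘ pr1) pr2 = b ×h idm B by prod_eq.
exact: exact_required (base_graph b).
Qed.

Lemma exact_graph_r (Z B : S) (b : Z ~> B) :
  ExactSquare C (pairing (idm Z) b) b (pairing pr2 (b ∘ pr1)) (diag B).
Proof.
have s2 := exact_iso (C := C) (f := diag B) (i := iso_id B) (j := swap_iso B) (k := diag B).
have s21 := exact_paste _ _ s2 (exact_graph_l (b := b)).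
have e1 : pairing pr2 (b ∘ pr1) = swap_iso B ∘ pairing (b ∘ pr1) pr2 by rewrite /=; prod_eq.
rewrite e1 -[X in ExactSquare _ _ X](comp_id_l b); apply: s21; rewrite /=; prod_eq.
Qed.

Definition fat2 (G : Ctx S) (A B : S) (M : C (A × B)) (a : CMap G (cvar A))
    (b : CMap G (cvar B)) : Fam C G :=
  fatom M (cpair a b).

Section Composition.
Context (A B D : S) (M : C (A × B)) (N : C (B × D)).

Let q1 : (A × B) × (B × D) ~> A × B := prunit (A × B) ∘ (idm (A × B) ×h proj (B × D)).
Let q2 : (A × B) × (B × D) ~> B × D := plunit (B × D) ∘ (proj (A × B) ×h idm (B × D)).

Definition odot_body : C (A × (B × D)) := re (diag_mid A B D) (re q1 M ⊗ re q2 N).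

Section Point.
Context (X : S) (a : X ~> A) (b : X ~> B) (d : X ~> D).

Lemma diag_mid_pt :
  diag_mid A B D ∘ pairing a (pairing b d) = pairing (pairing a b) (pairing b d).
Proof. by prod_eq. Qed.

Lemma contract_mid_pt : contract_mid A B D ∘ pairing a (pairing b d) = pairing a d.
Proof. by prod_eq. Qed.

Lemma ext_fst_pt : q1 ∘ pairing (pairing a b) (pairing b d) = pairing a b.
Proof. by rewrite /q1; prod_eq. Qed.

Lemma ext_snd_pt : q2 ∘ pairing (pairing a b) (pairing b d) = pairing b d.
Proof. by rewrite /q2; prod_eq. Qed.

(** By definition M ⊙ N is the pushforward of [odot_body]; this identifies [odot_body] at the
    point (a,(b,d)) with M(a,b) ⊗ N(b,d). *)
Definition odot_body_iso :
  Iso (re (pairing a b) M ⊗ re (pairing b d) N) (re (pairing a (pairing b d)) odot_body) :=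
  iso_comp (iso_sym (pb diag_mid_pt (re q1 M ⊗ re q2 N)))
    (iso_comp (fmul (re (pairing (pairing a b) (pairing b d))) (re q1 M) (re q2 N))
       (iso_fmap2 tensor (iso_sym (pb ext_fst_pt M)) (iso_sym (pb ext_snd_pt N)))).

Lemma odot_body_isoE :
  iso_hom odot_body_iso
  = inv (pb diag_mid_pt (re q1 M ⊗ re q2 N))
    ∘ (fmul (re (pairing (pairing a b) (pairing b d))) (re q1 M) (re q2 N)
       ∘ (inv (pb ext_fst_pt M) ⊗h inv (pb ext_snd_pt N))).
Proof. by rewrite /odot_body_iso !iso_compE. Qed.

Definition eta : re (pairing a b) M ⊗ re (pairing b d) N ~> re (pairing a d) (odot H A B D (M, N)) :=
  inst contract_mid_pt (adj_unit (push H (contract_mid A B D)) odot_body) ∘ odot_body_iso.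
End Point.

Section Family.
Context (G : Ctx S) (a : CMap G (cvar A)) (b : CMap G (cvar B)) (d : CMap G (cvar D)).

Lemma nat_odot_body_iso :
  @Nat S C G (ften (fat2 M a b) (fat2 N b d)) (fatom odot_body (cpair a (cpair b d)))
    (fun X g => odot_body_iso (a ⋅ g) (b ⋅ g) (d ⋅ g)).
Proof.
pose x := cpair (cpair a b) (cpair b d).
have n1 := nat_inv (nat_pb (x := x) (y := cpair a b) (D := M)
  (fun X g => ext_fst_pt (a ⋅ g) (b ⋅ g) (d ⋅ g))).
have n2 := nat_inv (nat_pb (x := x) (y := cpair b d) (D := N)
  (fun X g => ext_snd_pt (a ⋅ g) (b ⋅ g) (d ⋅ g))).
have n3 := @nat_fmul S C G _ (re q1 M) (re q2 N) x.
have n4 := nat_inv (nat_pb (x := cpair a (cpair b d))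
  (fun X g => diag_mid_pt (a ⋅ g) (b ⋅ g) (d ⋅ g)) (y := x) (D := re q1 M ⊗ re q2 N)).
have n := nat_comp n4 (nat_comp n3 (nat_ten n1 n2)).
move=> X Y h g g' e r r'; rewrite !odot_body_isoE.
exact: n.
Qed.

Lemma nat_eta :
  @Nat S C G (ften (fat2 M a b) (fat2 N b d)) (fat2 (odot H A B D (M, N)) a d)
    (fun X g => eta (a ⋅ g) (b ⋅ g) (d ⋅ g)).
Proof.
apply: nat_comp nat_odot_body_iso.
exact: (nat_inst (x := cpair a (cpair b d)) (y := cpair a d)
          (fun X g => contract_mid_pt (a ⋅ g) (b ⋅ g) (d ⋅ g))).
Qed.
End Family.
Arguments nat_odot_body_iso {G} a b d.

(** The unit of the adjunction is opcartesian, and [exact_mid] carries it to arbitrary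
    elements a and d. *)
Lemma univ_eta (G : Ctx S) (a : CMap G (cvar A)) (d : CMap G (cvar D)) :
  @Universal S C (cext G B) G (cfst G B)
    (ften (fat2 M (ccomp a (cfst G B)) (csnd G B)) (fat2 N (csnd G B) (ccomp d (cfst G B))))
    (fat2 (odot H A B D (M, N)) a d)
    (fun X g => eta (a ⋅ fst g) (snd g) (d ⋅ fst g)).
Proof.
pose a' := ccomp a (cfst G B); pose d' := ccomp d (cfst G B); pose b := csnd G B.
have u := @univ_inst S C (cext G B) G (cfst G B) _ _ (contract_mid A B D)
  (cpair a' (cpair b d')) (cpair a d) (fun X g => contract_mid_pt (a' ⋅ g) (b ⋅ g) (d' ⋅ g))
  odot_body (odot H A B D (M, N)) (adj_unit (push H (contract_mid A B D)) odot_body).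
have {}u := u _ (opc_unit _ _).
have ex : ExactSquare C (name (cfst G B ⋅ gen)) (cpair a' (cpair b d') ⋅ gen)
   (cpair a d ⋅ gen) (contract_mid A B D).
  rewrite /= name_act name_gen comp_id_l !cm_act /=.
  exact: exact_mid.
have := @univ_conj S C (cext G B) G (cfst G B) (fatom odot_body (cpair a' (cpair b d')))
  (ften (fat2 M a' b) (fat2 N b d')) (fat2 (odot H A B D (M, N)) a d) _
  (fun X g => odot_body_iso (a' ⋅ g) (b ⋅ g) (d' ⋅ g)) (fun X g => iso_id _) _
  (nat_odot_body_iso a' b d') (nat_id (F := _)) (u ex).
by apply: univ_ext => X g /=; rewrite comp_id_l.
Qed.
End Composition.

Lemma eta_nat (A B D : S) (M M' : C (A × B)) (N N' : C (B × D)) (f : M ~> M') (g : N ~> N')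
    (X : S) (a : X ~> A) (b : X ~> B) (d : X ~> D) :
  fmap (re (pairing a d)) (fmap2 (odot H A B D) f g) ∘ eta M N a b d
  = eta M' N' a b d ∘ (fmap (re (pairing a b)) f ⊗h fmap (re (pairing b d)) g).
Proof.
rewrite /eta /inst !odot_body_isoE; assoc_r.
rewrite (comp_tail (pb_nat _ _)) /fmap2 /=; assoc_r; congr (_ ∘ _).
rewrite (comp_tail (eq_sym (fmap_comp _ _ _))) -unit_nat fmap_comp; assoc_r; congr (_ ∘ _).
apply: (iso_monic (i := pb (diag_mid_pt a b d) _)); rewrite inv_r_tail.
rewrite /= (comp_tail (eq_sym (pb_nat _ _))); assoc_r; rewrite inv_r_tail.
rewrite (comp_tail (fmul_nat _ _ _)); assoc_r; congr (_ ∘ _).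
rewrite !fmap2_comp; congr (fmap2 _ _ _).
- apply: (iso_monic (i := pb (ext_fst_pt a b d) _)).
  by rewrite inv_r_tail (comp_tail (eq_sym (pb_nat _ _))) -comp_assoc inv_r comp_id_r.
- apply: (iso_monic (i := pb (ext_snd_pt a b d) _)).
  by rewrite inv_r_tail (comp_tail (eq_sym (pb_nat _ _))) -comp_assoc inv_r comp_id_r.
Qed.

Section Units.
Context (B : S).

Section Point.
Context (X : S) (b : X ~> B).

Lemma proj_pt : proj B ∘ b = proj X.
Proof. exact: star_uniq. Qed.

Lemma diag_pt : diag B ∘ b = pairing b b.
Proof. by prod_eq. Qed.

Definition unit_body_iso : Iso (munit : C X) (re b (re (proj B) munit)) :=
  iso_comp (iso_sym (pb proj_pt munit)) (fone (re (proj X))).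

Definition iota : munit ~> re (pairing b b) (ucell H B) :=
  inst diag_pt (adj_unit (push H (diag B)) (re (proj B) munit)) ∘ unit_body_iso.
End Point.

Lemma nat_unit_body_iso (G : Ctx S) (b : CMap G (cvar B)) :
  @Nat S C G (fone_fam C G) (fatom (re (proj B) munit) b) (fun X g => unit_body_iso (b ⋅ g)).
Proof.
have n1 := nat_inv (nat_pb (x := b) (y := cproj G) (D := (munit : C star))
  (fun X g => proj_pt (b ⋅ g))).
have n := nat_comp n1 (@nat_fone S C G star (cproj G)).
move=> X Y h g g' e r r'; rewrite /unit_body_iso !iso_compE.
exact: n.
Qed.
Arguments nat_unit_body_iso {G} b.

Lemma nat_iota (G : Ctx S) (b : CMap G (cvar B)) :
  @Nat S C G (fone_fam C G) (fat2 (ucell H B) b b) (fun X g => iota (b ⋅ g)).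
Proof.
apply: nat_comp (nat_unit_body_iso b).
exact: (nat_inst (x := b) (y := cpair b b) (fun X g => diag_pt (b ⋅ g))).
Qed.

(** As for [univ_eta], now with the graph square of b. *)
Lemma univ_iota_l (G : Ctx S) (b : CMap G (cvar B)) :
  @Universal S C G (cext G B) (cgraph b) (fone_fam C G)
    (fat2 (ucell H B) (ccomp b (cfst G B)) (csnd G B)) (fun X g => iota (b ⋅ g)).
Proof.
have u := @univ_inst S C G (cext G B) (cgraph b) _ _ (diag B) b
  (cpair (ccomp b (cfst G B)) (csnd G B)) (fun X g => diag_pt (b ⋅ g))
  (re (proj B) munit) (ucell H B) (adj_unit (push H (diag B)) (re (proj B) munit)).
have ex : ExactSquare C (name (cgraph b ⋅ gen)) (b ⋅ gen)
   (cpair (ccomp b (cfst G B)) (csnd G B) ⋅ gen) (diag B).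
  by rewrite /= name_gen !cm_act /=; exact: exact_graph_l.
have := @univ_conj S C G (cext G B) (cgraph b) (fatom (re (proj B) munit) b) (fone_fam C G)
  (fat2 (ucell H B) (ccomp b (cfst G B)) (csnd G B)) _
  (fun X g => unit_body_iso (b ⋅ g)) (fun X g => iso_id _) _
  (nat_unit_body_iso b) (nat_id (F := _)) (u ex (opc_unit _ _)).
by apply: univ_ext => X g /=; rewrite comp_id_l.
Qed.

Lemma univ_iota_r (G : Ctx S) (b : CMap G (cvar B)) :
  @Universal S C G (cext G B) (cgraph b) (fone_fam C G)
    (fat2 (ucell H B) (csnd G B) (ccomp b (cfst G B))) (fun X g => iota (b ⋅ g)).
Proof.
have u := @univ_inst S C G (cext G B) (cgraph b) _ _ (diag B) b
  (cpair (csnd G B) (ccomp b (cfst G B))) (fun X g => diag_pt (b ⋅ g))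
  (re (proj B) munit) (ucell H B) (adj_unit (push H (diag B)) (re (proj B) munit)).
have ex : ExactSquare C (name (cgraph b ⋅ gen)) (b ⋅ gen)
   (cpair (csnd G B) (ccomp b (cfst G B)) ⋅ gen) (diag B).
  by rewrite /= name_gen !cm_act /=; exact: exact_graph_r.
have := @univ_conj S C G (cext G B) (cgraph b) (fatom (re (proj B) munit) b) (fone_fam C G)
  (fat2 (ucell H B) (csnd G B) (ccomp b (cfst G B))) _
  (fun X g => unit_body_iso (b ⋅ g)) (fun X g => iso_id _) _
  (nat_unit_body_iso b) (nat_id (F := _)) (u ex (opc_unit _ _)).
by apply: univ_ext => X g /=; rewrite comp_id_l.
Qed.
End Units.

Section Trace.
Context (A : S).

Definition tr (M : C (A × A)) (X : S) (a : X ~> A) :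
    re (pairing a a) M ~> re (proj X) (shadow H A M) :=
  inst (proj_pt a) (adj_unit (push H (proj A)) (re (diag A) M)) ∘ inv (pb (diag_pt a) M).

Lemma tr_nat (M M' : C (A × A)) (f : M ~> M') (X : S) (a : X ~> A) :
  fmap (re (proj X)) (fmap (shadow H A) f) ∘ tr M a
  = tr M' a ∘ fmap (re (pairing a a)) f.
Proof.
rewrite /tr /inst /=; assoc_r.
rewrite (comp_tail (pb_nat _ _)); assoc_r; congr (_ ∘ _).
rewrite (comp_tail (eq_sym (fmap_comp _ _ _))) -unit_nat fmap_comp; assoc_r; congr (_ ∘ _).
apply: (iso_monic (i := pb (diag_pt a) _)); rewrite inv_r_tail.
by rewrite (comp_tail (eq_sym (pb_nat _ _))) -comp_assoc inv_r comp_id_r.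
Qed.

Lemma nat_tr (M : C (A × A)) (G : Ctx S) (a : CMap G (cvar A)) :
  @Nat S C G (fat2 M a a) (fatom (shadow H A M) (cproj G)) (fun X g => tr M (a ⋅ g)).
Proof.
have n1 := nat_inv (nat_pb (x := a) (fun X g => diag_pt (a ⋅ g)) (y := cpair a a) (D := M)).
have n2 := nat_inst (x := a) (y := cproj G) (fun X g => proj_pt (a ⋅ g))
  (adj_unit (push H (proj A)) (re (diag A) M)).
exact: (nat_comp n2 n1).
Qed.

(** Over the empty context the representing object is terminal, so the defining adjunction
    is used without change of base. *)
Lemma univ_tr (M : C (A × A)) :
  @Universal S C (cvar A) (cnil S) (cto_nil (cvar A)) (fat2 M (cid (cvar A)) (cid (cvar A)))
    (fatom (shadow H A M) (cproj (cnil S))) (fun X g => tr M g).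
Proof.
pose i := cid (cvar A).
have u := @univ_inst S C (cvar A) (cnil S) (cto_nil (cvar A)) _ _ (proj A) i
  (cproj (cnil S)) (fun X g => proj_pt (i ⋅ g))
  (re (diag A) M) (shadow H A M) (adj_unit (push H (proj A)) (re (diag A) M)).
have ex : ExactSquare C (name (cto_nil (cvar A) ⋅ gen)) (i ⋅ gen)
   (cproj (cnil S) ⋅ gen) (proj A).
  rewrite /= (star_uniq (proj star) (idm star)).
  exact: (exact_iso (i := iso_id A) (j := iso_id star)).
have n1 := nat_inv (nat_pb (x := i) (fun X g => diag_pt (i ⋅ g)) (y := cpair i i) (D := M)).
have := @univ_conj S C (cvar A) (cnil S) (cto_nil (cvar A)) (fatom (re (diag A) M) i)
  (fat2 M i i) (fatom (shadow H A M) (cproj (cnil S))) _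
  (fun X g => iso_sym (pb (diag_pt (i ⋅ g)) M)) (fun X g => iso_id _) _
  n1 (nat_id (F := _)) (u ex (opc_unit _ _)).
by apply: univ_ext => X g /=; rewrite comp_id_l.
Qed.
End Trace.
End Cells.

(** * The bicategory *)

Section BicategoryOfSpans.
Context (S : CatWithFiniteProducts) (C : IndexedSymMonCat S).
Context (H : IndexedHomotopyCoproducts C).

Local Notation "M ⊙ N" := (odot H _ _ _ (M, N)) (at level 36, left associativity).
Local Notation "M ⟨ a , b ⟩" := (re (pairing a b) M) (at level 8, format "M ⟨ a ,  b ⟩").
Local Notation "u ⟪ a , b ⟫" := (fmap (re (pairing a b)) u) (at level 8, format "u ⟪ a ,  b ⟫").
Local Notation η := (eta H).
Local Notation ι := (iota H).

(** ** Iterated composites *)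

Section Threefold.
Context (A B D E : S) (M : C (A × B)) (N : C (B × D)) (P : C (D × E)).

Definition eta_l (X : S) (a : X ~> A) (b : X ~> B) (d : X ~> D) (e : X ~> E) :
    (M⟨a, b⟩ ⊗ N⟨b, d⟩) ⊗ P⟨d, e⟩ ~> ((M ⊙ N) ⊙ P)⟨a, e⟩ :=
  η (M ⊙ N) P a d e ∘ (η M N a b d ⊗h idm (P⟨d, e⟩)).

Definition eta_r (X : S) (a : X ~> A) (b : X ~> B) (d : X ~> D) (e : X ~> E) :
    M⟨a, b⟩ ⊗ (N⟨b, d⟩ ⊗ P⟨d, e⟩) ~> (M ⊙ (N ⊙ P))⟨a, e⟩ :=
  η M (N ⊙ P) a b e ∘ (idm (M⟨a, b⟩) ⊗h η N P b d e).

Lemma nat_eta_l (G : Ctx S) (a : CMap G (cvar A)) (b : CMap G (cvar B)) (d : CMap G (cvar D))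
    (e : CMap G (cvar E)) :
  @Nat S C G (ften (ften (fat2 M a b) (fat2 N b d)) (fat2 P d e))
    (fat2 ((M ⊙ N) ⊙ P) a e) (fun X g => eta_l (a ⋅ g) (b ⋅ g) (d ⋅ g) (e ⋅ g)).
Proof.
apply: (nat_comp (@nat_eta S C H _ _ _ (M ⊙ N) P G a d e)).
exact: (nat_ten (@nat_eta S C H _ _ _ M N G a b d) (nat_id (F := fat2 P d e))).
Qed.

Lemma nat_eta_r (G : Ctx S) (a : CMap G (cvar A)) (b : CMap G (cvar B)) (d : CMap G (cvar D))
    (e : CMap G (cvar E)) :
  @Nat S C G (ften (fat2 M a b) (ften (fat2 N b d) (fat2 P d e)))
    (fat2 (M ⊙ (N ⊙ P)) a e) (fun X g => eta_r (a ⋅ g) (b ⋅ g) (d ⋅ g) (e ⋅ g)).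
Proof.
apply: (nat_comp (@nat_eta S C H _ _ _ M (N ⊙ P) G a b e)).
exact: (nat_ten (nat_id (F := fat2 M a b)) (@nat_eta S C H _ _ _ N P G b d e)).
Qed.

Arguments nat_eta_l {G} a b d e.
Arguments nat_eta_r {G} a b d e.

Lemma univ_eta_ll (G : Ctx S) (a : CMap G (cvar A)) (e : CMap G (cvar E)) :
  @Universal S C (cext (cext G D) B) G (ccomp (cfst G D) (cfst (cext G D) B))
    (let p := ccomp (cfst G D) (cfst (cext G D) B) in
     let b := csnd (cext G D) B in let d := ccomp (csnd G D) (cfst (cext G D) B) in
     ften (ften (fat2 M (ccomp a p) b) (fat2 N b d)) (fat2 P d (ccomp e p)))
    (fat2 ((M ⊙ N) ⊙ P) a e)
    (fun X g => eta_l (a ⋅ fst (fst g)) (snd g) (snd (fst g)) (e ⋅ fst (fst g))).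
Proof.
have u1 := univ_eta H (M ⊙ N) P a e.
have u2 := univ_eta H M N (ccomp a (cfst G D)) (csnd G D).
exact_universal (univ_comp (univ_ten_r H (fat2 P (csnd G D) (ccomp e (cfst G D))) u2) u1).
Qed.

Lemma univ_eta_rr (G : Ctx S) (a : CMap G (cvar A)) (e : CMap G (cvar E)) :
  @Universal S C (cext (cext G B) D) G (ccomp (cfst G B) (cfst (cext G B) D))
    (let p := ccomp (cfst G B) (cfst (cext G B) D) in
     let d := csnd (cext G B) D in let b := ccomp (csnd G B) (cfst (cext G B) D) in
     ften (fat2 M (ccomp a p) b) (ften (fat2 N b d) (fat2 P d (ccomp e p))))
    (fat2 (M ⊙ (N ⊙ P)) a e)
    (fun X g => eta_r (a ⋅ fst (fst g)) (snd (fst g)) (snd g) (e ⋅ fst (fst g))).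
Proof.
have u1 := univ_eta H M (N ⊙ P) a e.
have u2 := univ_eta H N P (csnd G B) (ccomp e (cfst G B)).
exact_universal (univ_comp (univ_ten_l H (fat2 M (ccomp a (cfst G B)) (csnd G B)) u2) u1).
Qed.

End Threefold.
Arguments nat_eta_l {A B D E} M N P {G} a b d e.
Arguments nat_eta_r {A B D E} M N P {G} a b d e.

Section TwoVariables.
Context (A D : S).
Let G := cext (cvar A) D.
Let a : CMap G (cvar A) := cfst (cvar A) D.
Let d : CMap G (cvar D) := csnd (cvar A) D.

Lemma cpair_gen : cpair a d ⋅ gen = idm (cob G).
Proof. by rewrite /= comp_id_l -[RHS]pair_uniq !comp_id_r. Qed.

Lemma eta_l_ext (B E : S) (M : C (A × B)) (N : C (B × E)) (P : C (E × D)) (W : C (A × D))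
    (f f' : (M ⊙ N) ⊙ P ~> W) :
  (forall (X : S) (a : X ~> A) (b : X ~> B) (e : X ~> E) (d : X ~> D),
     f⟪a, d⟫ ∘ eta_l M N P a b e d = f'⟪a, d⟫ ∘ eta_l M N P a b e d) -> f = f'.
Proof.
by move=> e; apply: (univ_hom_ext (G := G) cpair_gen (univ_eta_ll M N P a d)) => X g; exact: e.
Qed.

Lemma eta_r_ext (B E : S) (M : C (A × B)) (N : C (B × E)) (P : C (E × D)) (W : C (A × D))
    (f f' : M ⊙ (N ⊙ P) ~> W) :
  (forall (X : S) (a : X ~> A) (b : X ~> B) (e : X ~> E) (d : X ~> D),
     f⟪a, d⟫ ∘ eta_r M N P a b e d = f'⟪a, d⟫ ∘ eta_r M N P a b e d) -> f = f'.
Proof.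
by move=> e; apply: (univ_hom_ext (G := G) cpair_gen (univ_eta_rr M N P a d)) => X g; exact: e.
Qed.
End TwoVariables.

(** ** The associator *)

Section Associator.
Context (A B D E : S) (M : C (A × B)) (N : C (B × D)) (P : C (D × E)).

(** Both bracketings of the composite represent maps out of the corresponding threefold
    tensor product, and the associator of ⊗ identifies these tensor products. *)
Lemma assoc_exists :
  exists i : Iso ((M ⊙ N) ⊙ P) (M ⊙ (N ⊙ P)),
    forall (X : S) (a : X ~> A) (b : X ~> B) (d : X ~> D) (e : X ~> E),
      i⟪a, e⟫ ∘ eta_l M N P a b d e = eta_r M N P a b d e ∘ massoc _ _ _.
Proof.
pose G := cext (cvar A) E.
pose a : CMap G (cvar A) := cfst (cvar A) E.
pose e : CMap G (cvar E) := csnd (cvar A) E.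
have [f ef] : exists f : (M ⊙ N) ⊙ P ~> M ⊙ (N ⊙ P),
    forall (X : S) (a : X ~> A) (b : X ~> B) (d : X ~> D) (e : X ~> E),
      f⟪a, e⟫ ∘ eta_l M N P a b d e = eta_r M N P a b d e ∘ massoc _ _ _.
  pose p := ccomp (cfst G D) (cfst (cext G D) B).
  pose b := csnd (cext G D) B; pose d := ccomp (csnd G D) (cfst (cext G D) B).
  have n := nat_comp (nat_eta_r M N P (ccomp a p) b d (ccomp e p))
             (nat_massoc (F1 := _) (F2 := _) (F3 := _)).
  have [f ef] := univ_hom_factor (cpair_gen A E) (univ_eta_ll M N P a e) n.
  by exists f => X a' b' d' e'; exact: (ef X (((a', e'), d'), b')).
have [h eh] : exists h : M ⊙ (N ⊙ P) ~> (M ⊙ N) ⊙ P,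
    forall (X : S) (a : X ~> A) (b : X ~> B) (d : X ~> D) (e : X ~> E),
      h⟪a, e⟫ ∘ eta_r M N P a b d e = eta_l M N P a b d e ∘ inv (massoc _ _ _).
  pose p := ccomp (cfst G B) (cfst (cext G B) D).
  pose d := csnd (cext G B) D; pose b := ccomp (csnd G B) (cfst (cext G B) D).
  have n := nat_comp (nat_eta_l M N P (ccomp a p) b d (ccomp e p))
             (nat_inv (nat_massoc (F1 := _) (F2 := _) (F3 := _))).
  have [h eh] := univ_hom_factor (cpair_gen A E) (univ_eta_rr M N P a e) n.
  by exists h => X a' b' d' e'; exact: (eh X (((a', e'), b'), d')).
have l : h ∘ f = idm _.
  apply: eta_l_ext => X a' b' d' e'.
  rewrite fmap_comp fmap_id comp_id_l -comp_assoc ef comp_assoc eh -comp_assoc inv_l.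
  exact: comp_id_r.
have r : f ∘ h = idm _.
  apply: eta_r_ext => X a' b' d' e'.
  rewrite fmap_comp fmap_id comp_id_l -comp_assoc eh comp_assoc ef -comp_assoc inv_r.
  exact: comp_id_r.
by exists (Build_Iso l r).
Qed.

Definition odot_assoc : Iso ((M ⊙ N) ⊙ P) (M ⊙ (N ⊙ P)) :=
  proj1_sig (constructive_indefinite_description _ assoc_exists).

Lemma odot_assocE (X : S) (a : X ~> A) (b : X ~> B) (d : X ~> D) (e : X ~> E) :
  odot_assoc⟪a, e⟫ ∘ eta_l M N P a b d e = eta_r M N P a b d e ∘ massoc _ _ _.
Proof. exact: (proj2_sig (constructive_indefinite_description _ assoc_exists)). Qed.
End Associator.

Lemma eta_l_nat (A B D E : S) (M M' : C (A × B)) (N N' : C (B × D)) (P P' : C (D × E))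
    (f : M ~> M') (g : N ~> N') (h : P ~> P')
    (X : S) (a : X ~> A) (b : X ~> B) (d : X ~> D) (e : X ~> E) :
  (fmap2 (odot H _ _ _) (fmap2 (odot H _ _ _) f g) h)⟪a, e⟫ ∘ eta_l M N P a b d e
  = eta_l M' N' P' a b d e ∘ ((f⟪a, b⟫ ⊗h g⟪b, d⟫) ⊗h h⟪d, e⟫).
Proof.
rewrite /eta_l (comp_tail (eta_nat _ _ _ _ _ _)); assoc_r.
by rewrite !fmap2_comp eta_nat comp_id_l comp_id_r.
Qed.

Lemma eta_r_nat (A B D E : S) (M M' : C (A × B)) (N N' : C (B × D)) (P P' : C (D × E))
    (f : M ~> M') (g : N ~> N') (h : P ~> P')
    (X : S) (a : X ~> A) (b : X ~> B) (d : X ~> D) (e : X ~> E) :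
  (fmap2 (odot H _ _ _) f (fmap2 (odot H _ _ _) g h))⟪a, e⟫ ∘ eta_r M N P a b d e
  = eta_r M' N' P' a b d e ∘ (f⟪a, b⟫ ⊗h (g⟪b, d⟫ ⊗h h⟪d, e⟫)).
Proof.
rewrite /eta_r (comp_tail (eta_nat _ _ _ _ _ _)); assoc_r.
by rewrite !fmap2_comp eta_nat comp_id_l comp_id_r.
Qed.

Lemma odot_assoc_nat (A B D E : S) (M M' : C (A × B)) (N N' : C (B × D)) (P P' : C (D × E))
    (f : M ~> M') (g : N ~> N') (h : P ~> P') :
  fmap2 (odot H _ _ _) f (fmap2 (odot H _ _ _) g h) ∘ odot_assoc M N P
  = odot_assoc M' N' P' ∘ fmap2 (odot H _ _ _) (fmap2 (odot H _ _ _) f g) h.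
Proof.
apply: eta_l_ext => X a b d e; rewrite !fmap_comp; assoc_r.
rewrite odot_assocE eta_l_nat (comp_tail (eta_r_nat _ _ _ _ _ _ _)); assoc_r.
by rewrite massoc_nat (comp_tail (odot_assocE _ _ _ _ _ _ _)); assoc_r.
Qed.

Section Pentagon.
Context (A B D E F : S).
Context (M : C (A × B)) (N : C (B × D)) (P : C (D × E)) (Q : C (E × F)).

Definition eta_ll (X : S) (a : X ~> A) (b : X ~> B) (d : X ~> D) (e : X ~> E) (z : X ~> F) :
    ((M⟨a, b⟩ ⊗ N⟨b, d⟩) ⊗ P⟨d, e⟩) ⊗ Q⟨e, z⟩ ~> (((M ⊙ N) ⊙ P) ⊙ Q)⟨a, z⟩ :=
  η ((M ⊙ N) ⊙ P) Q a e z ∘ (eta_l M N P a b d e ⊗h idm (Q⟨e, z⟩)).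

Lemma eta_ll_ext (W : C (A × F)) (f f' : ((M ⊙ N) ⊙ P) ⊙ Q ~> W) :
  (forall (X : S) (a : X ~> A) (b : X ~> B) (d : X ~> D) (e : X ~> E) (z : X ~> F),
     f⟪a, z⟫ ∘ eta_ll a b d e z = f'⟪a, z⟫ ∘ eta_ll a b d e z) -> f = f'.
Proof.
pose G := cext (cvar A) F.
pose a : CMap G (cvar A) := cfst (cvar A) F.
pose z : CMap G (cvar F) := csnd (cvar A) F.
have u1 := univ_eta H ((M ⊙ N) ⊙ P) Q a z.
have u2 := univ_eta_ll M N P (ccomp a (cfst G E)) (csnd G E).
have u3 := univ_comp (univ_ten_r H (fat2 Q (csnd G E) (ccomp z (cfst G E))) u2) u1.
move=> e; apply: (univ_hom_ext (cpair_gen A F) u3) => X g; exact: e.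
Qed.

(** Evaluated on the fourfold tensor product, each of the five associators becomes an
    associator of ⊗ by [odot_assocE], and the two sides become those of the pentagon in the
    fibre. *)
Lemma odot_pentagon :
  odot_assoc M N (P ⊙ Q) ∘ odot_assoc (M ⊙ N) P Q
  = fmap2 (odot H _ _ _) (idm M) (odot_assoc N P Q) ∘ odot_assoc M (N ⊙ P) Q
    ∘ fmap2 (odot H _ _ _) (odot_assoc M N P) (idm Q).
Proof.
apply: eta_ll_ext => X a b d e z; rewrite !fmap_comp; assoc_r.
have e1 : eta_ll a b d e z
    = eta_l (M ⊙ N) P Q a d e z ∘ ((η M N a b d ⊗h idm _) ⊗h idm _).
  by rewrite /eta_ll /eta_l -comp_assoc !fmap2_comp comp_id_l.
rewrite [in LHS]e1.
rewrite (comp_tail (odot_assocE (M ⊙ N) P Q a d e z)); assoc_r.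
have -> : eta_r (M ⊙ N) P Q a d e z ∘ (massoc _ _ _ ∘ ((η M N a b d ⊗h idm _) ⊗h idm _))
    = eta_l M N (P ⊙ Q) a b d z ∘ ((idm _ ⊗h η P Q d e z) ∘ massoc _ _ _).
  rewrite /eta_r /eta_l; assoc_r; rewrite -massoc_nat fmap2_id.
  by rewrite !(comp_tail (fmap2_comp _ _ _ _ _)) !comp_id_l !comp_id_r.
rewrite (comp_tail (odot_assocE M N (P ⊙ Q) a b d z)); assoc_r.
rewrite /eta_ll.
rewrite (comp_tail (eta_nat _ _ _ _ _ _)); assoc_r.
rewrite fmap2_comp odot_assocE fmap_id.
have -> : η (M ⊙ (N ⊙ P)) Q a e z
      ∘ ((eta_r M N P a b d e ∘ massoc _ _ _) ⊗h (idm (Q⟨e, z⟩) ∘ idm (Q⟨e, z⟩)))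
    = eta_l M (N ⊙ P) Q a b e z
      ∘ (((idm _ ⊗h η N P b d e) ⊗h idm _) ∘ (massoc _ _ _ ⊗h idm _)).
  by rewrite /eta_r /eta_l; assoc_r; rewrite !fmap2_comp !comp_id_l; assoc_r.
rewrite (comp_tail (odot_assocE M (N ⊙ P) Q a b e z)); assoc_r.
rewrite (comp_tail (eq_sym (massoc_nat _ _ _))) /eta_r; assoc_r.
rewrite (comp_tail (eta_nat _ _ _ _ _ _)) fmap_id; assoc_r.
rewrite !(comp_tail (fmap2_comp _ _ _ _ _)) !comp_id_l.
have e2 := odot_assocE N P Q b d e z; rewrite /eta_l in e2.
rewrite -comp_assoc e2 -(comp_id_l (idm (M⟨a, b⟩))) -[in RHS]fmap2_comp; assoc_r.
have e3 := mpentagon (M⟨a, b⟩) (N⟨b, d⟩) (P⟨d, e⟩) (Q⟨e, z⟩); rewrite -comp_assoc in e3.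
rewrite -e3 comp_id_l -fmap2_id (comp_tail (eq_sym (massoc_nat _ _ _))); assoc_r.
by rewrite (comp_tail (fmap2_comp _ _ _ _ _)) comp_id_l.
Qed.
End Pentagon.

(** ** Units *)

Local Notation U A := (ucell H A).

Section OneUnit.
Context (A B : S) (M : C (A × B)).

Definition eta_ul (X : S) (a : X ~> A) (b : X ~> B) :
    munit ⊗ M⟨a, b⟩ ~> (U A ⊙ M)⟨a, b⟩ :=
  η (U A) M a a b ∘ (ι a ⊗h idm (M⟨a, b⟩)).

Definition eta_ur (X : S) (a : X ~> A) (b : X ~> B) :
    M⟨a, b⟩ ⊗ munit ~> (M ⊙ U B)⟨a, b⟩ :=
  η M (U B) a b b ∘ (idm (M⟨a, b⟩) ⊗h ι b).

Lemma nat_eta_ul (G : Ctx S) (a : CMap G (cvar A)) (b : CMap G (cvar B)) :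
  @Nat S C G (ften (fone_fam C G) (fat2 M a b)) (fat2 (U A ⊙ M) a b)
    (fun X g => eta_ul (a ⋅ g) (b ⋅ g)).
Proof.
apply: (nat_comp (@nat_eta S C H _ _ _ (U A) M G a a b)).
exact: (nat_ten (@nat_iota S C H A G a) (nat_id (F := fat2 M a b))).
Qed.

Lemma nat_eta_ur (G : Ctx S) (a : CMap G (cvar A)) (b : CMap G (cvar B)) :
  @Nat S C G (ften (fat2 M a b) (fone_fam C G)) (fat2 (M ⊙ U B) a b)
    (fun X g => eta_ur (a ⋅ g) (b ⋅ g)).
Proof.
apply: (nat_comp (@nat_eta S C H _ _ _ M (U B) G a b b)).
exact: (nat_ten (nat_id (F := fat2 M a b)) (@nat_iota S C H B G b)).
Qed.
Arguments nat_eta_ul {G} a b.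
Arguments nat_eta_ur {G} a b.

Lemma univ_eta_ul (G : Ctx S) (a : CMap G (cvar A)) (b : CMap G (cvar B)) :
  @Universal S C G G (ccomp (cfst G A) (cgraph a)) (ften (fone_fam C G) (fat2 M a b))
    (fat2 (U A ⊙ M) a b) (fun X g => eta_ul (a ⋅ g) (b ⋅ g)).
Proof.
have u1 := univ_eta H (U A) M a b.
have u2 := univ_ten_r H (fat2 M (csnd G A) (ccomp b (cfst G A))) (univ_iota_l H a).
exact_universal (univ_comp u2 u1).
Qed.

Lemma univ_eta_ur (G : Ctx S) (a : CMap G (cvar A)) (b : CMap G (cvar B)) :
  @Universal S C G G (ccomp (cfst G B) (cgraph b)) (ften (fat2 M a b) (fone_fam C G))
    (fat2 (M ⊙ U B) a b) (fun X g => eta_ur (a ⋅ g) (b ⋅ g)).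
Proof.
have u1 := univ_eta H M (U B) a b.
have u2 := univ_ten_l H (fat2 M (ccomp a (cfst G B)) (csnd G B)) (univ_iota_r H b).
exact_universal (univ_comp u2 u1).
Qed.

Let G := cext (cvar A) B.
Let a0 : CMap G (cvar A) := cfst (cvar A) B.
Let b0 : CMap G (cvar B) := csnd (cvar A) B.

Lemma eta_ul_ext (W : C (A × B)) (f f' : U A ⊙ M ~> W) :
  (forall (X : S) (a : X ~> A) (b : X ~> B), f⟪a, b⟫ ∘ eta_ul a b = f'⟪a, b⟫ ∘ eta_ul a b) ->
  f = f'.
Proof.
by move=> e; apply: (univ_hom_ext (cpair_gen A B) (univ_eta_ul a0 b0)) => X g; exact: e.
Qed.

Lemma eta_ur_ext (W : C (A × B)) (f f' : M ⊙ U B ~> W) :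
  (forall (X : S) (a : X ~> A) (b : X ~> B), f⟪a, b⟫ ∘ eta_ur a b = f'⟪a, b⟫ ∘ eta_ur a b) ->
  f = f'.
Proof.
by move=> e; apply: (univ_hom_ext (cpair_gen A B) (univ_eta_ur a0 b0)) => X g; exact: e.
Qed.

Lemma pairing_faithful (W : C (A × B)) (f f' : M ~> W) :
  (forall (X : S) (a : X ~> A) (b : X ~> B), f⟪a, b⟫ = f'⟪a, b⟫) -> f = f'.
Proof. move=> e; apply: (re_gen_faithful (cpair_gen A B)); exact: e. Qed.

(** The inverse is given directly: it is [eta_ul] after inserting I, a natural map between
    atoms. *)
Lemma lunit_exists :
  exists i : Iso (U A ⊙ M) M,
    forall (X : S) (a : X ~> A) (b : X ~> B), i⟪a, b⟫ ∘ eta_ul a b = mlunit _.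
Proof.
have [f ef] := univ_hom_factor (cpair_gen A B) (univ_eta_ul a0 b0)
  (nat_mlunit (F := fat2 M a0 b0)).
have {}ef X (a : X ~> A) (b : X ~> B) : f⟪a, b⟫ ∘ eta_ul a b = mlunit _ by exact: (ef X (a, b)).
have n := nat_comp (nat_eta_ul a0 b0) (nat_inv (nat_mlunit (F := fat2 M a0 b0))).
have [h eh] := nat_lower (cpair_gen A B) n.
have {}eh X (a : X ~> A) (b : X ~> B) : h⟪a, b⟫ = eta_ul a b ∘ inv (mlunit _)
  by exact: (eh X (a, b)).
have l : h ∘ f = idm _.
  apply: eta_ul_ext => X a b; rewrite fmap_comp fmap_id comp_id_l -comp_assoc ef eh.
  by rewrite -comp_assoc inv_l comp_id_r.
have r : f ∘ h = idm _.
  apply: pairing_faithful => X a b; rewrite fmap_comp fmap_id eh comp_assoc ef.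
  exact: inv_r.
by exists (Build_Iso l r).
Qed.

Lemma runit_exists :
  exists i : Iso (M ⊙ U B) M,
    forall (X : S) (a : X ~> A) (b : X ~> B), i⟪a, b⟫ ∘ eta_ur a b = mrunit _.
Proof.
have [f ef] := univ_hom_factor (cpair_gen A B) (univ_eta_ur a0 b0)
  (nat_mrunit (F := fat2 M a0 b0)).
have {}ef X (a : X ~> A) (b : X ~> B) : f⟪a, b⟫ ∘ eta_ur a b = mrunit _ by exact: (ef X (a, b)).
have n := nat_comp (nat_eta_ur a0 b0) (nat_inv (nat_mrunit (F := fat2 M a0 b0))).
have [h eh] := nat_lower (cpair_gen A B) n.
have {}eh X (a : X ~> A) (b : X ~> B) : h⟪a, b⟫ = eta_ur a b ∘ inv (mrunit _)
  by exact: (eh X (a, b)).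
have l : h ∘ f = idm _.
  apply: eta_ur_ext => X a b; rewrite fmap_comp fmap_id comp_id_l -comp_assoc ef eh.
  by rewrite -comp_assoc inv_l comp_id_r.
have r : f ∘ h = idm _.
  apply: pairing_faithful => X a b; rewrite fmap_comp fmap_id eh comp_assoc ef.
  exact: inv_r.
by exists (Build_Iso l r).
Qed.

Definition odot_lunit : Iso (U A ⊙ M) M :=
  proj1_sig (constructive_indefinite_description _ lunit_exists).

Lemma odot_lunitE (X : S) (a : X ~> A) (b : X ~> B) :
  odot_lunit⟪a, b⟫ ∘ eta_ul a b = mlunit _.
Proof. exact: (proj2_sig (constructive_indefinite_description _ lunit_exists)). Qed.

Definition odot_runit : Iso (M ⊙ U B) M :=
  proj1_sig (constructive_indefinite_description _ runit_exists).

Lemma odot_runitE (X : S) (a : X ~> A) (b : X ~> B) :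
  odot_runit⟪a, b⟫ ∘ eta_ur a b = mrunit _.
Proof. exact: (proj2_sig (constructive_indefinite_description _ runit_exists)). Qed.
End OneUnit.

Lemma eta_ul_nat (A B : S) (M M' : C (A × B)) (f : M ~> M') (X : S) (a : X ~> A) (b : X ~> B) :
  (fmap2 (odot H _ _ _) (idm (U A)) f)⟪a, b⟫ ∘ eta_ul M a b
  = eta_ul M' a b ∘ (idm munit ⊗h f⟪a, b⟫).
Proof.
rewrite /eta_ul (comp_tail (eta_nat _ _ _ _ _ _)); assoc_r.
by rewrite !fmap2_comp fmap_id !comp_id_l !comp_id_r.
Qed.

Lemma eta_ur_nat (A B : S) (M M' : C (A × B)) (f : M ~> M') (X : S) (a : X ~> A) (b : X ~> B) :
  (fmap2 (odot H _ _ _) f (idm (U B)))⟪a, b⟫ ∘ eta_ur M a b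
  = eta_ur M' a b ∘ (f⟪a, b⟫ ⊗h idm munit).
Proof.
rewrite /eta_ur (comp_tail (eta_nat _ _ _ _ _ _)); assoc_r.
by rewrite !fmap2_comp fmap_id !comp_id_l !comp_id_r.
Qed.

Lemma odot_lunit_nat (A B : S) (M M' : C (A × B)) (f : M ~> M') :
  f ∘ odot_lunit M = odot_lunit M' ∘ fmap2 (odot H _ _ _) (idm (U A)) f.
Proof.
apply: eta_ul_ext => X a b; rewrite !fmap_comp; assoc_r.
by rewrite odot_lunitE eta_ul_nat (comp_tail (odot_lunitE _ _ _)) mlunit_nat.
Qed.

Lemma odot_runit_nat (A B : S) (M M' : C (A × B)) (f : M ~> M') :
  f ∘ odot_runit M = odot_runit M' ∘ fmap2 (odot H _ _ _) f (idm (U B)).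
Proof.
apply: eta_ur_ext => X a b; rewrite !fmap_comp; assoc_r.
by rewrite odot_runitE eta_ur_nat (comp_tail (odot_runitE _ _ _)) mrunit_nat.
Qed.

Section Triangle.
Context (A B D : S) (M : C (A × B)) (N : C (B × D)).

(** The universal map out of the tensor product with I in the middle, on which the triangle
    is tested. *)
Definition eta_um (X : S) (a : X ~> A) (b : X ~> B) (d : X ~> D) :
    (M⟨a, b⟩ ⊗ munit) ⊗ N⟨b, d⟩ ~> ((M ⊙ U B) ⊙ N)⟨a, d⟩ :=
  η (M ⊙ U B) N a b d ∘ (eta_ur M a b ⊗h idm (N⟨b, d⟩)).

Lemma eta_um_ext (W : C (A × D)) (f f' : (M ⊙ U B) ⊙ N ~> W) :
  (forall (X : S) (a : X ~> A) (b : X ~> B) (d : X ~> D),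
     f⟪a, d⟫ ∘ eta_um a b d = f'⟪a, d⟫ ∘ eta_um a b d) -> f = f'.
Proof.
pose G := cext (cvar A) D.
pose a : CMap G (cvar A) := cfst (cvar A) D.
pose d : CMap G (cvar D) := csnd (cvar A) D.
have u1 := univ_eta H (M ⊙ U B) N a d.
have u2 := univ_eta_ur M (ccomp a (cfst G B)) (csnd G B).
have u3 := univ_comp (univ_ten_r H (fat2 N (csnd G B) (ccomp d (cfst G B))) u2) u1.
move=> e; apply: (univ_hom_ext (cpair_gen A D) u3) => X g; exact: e.
Qed.

Lemma odot_triangle :
  fmap2 (odot H _ _ _) (idm M) (odot_lunit N) ∘ odot_assoc M (U B) N
  = fmap2 (odot H _ _ _) (odot_runit M) (idm N).
Proof.
apply: eta_um_ext => X a b d; rewrite fmap_comp; assoc_r.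
have e1 : eta_um a b d = eta_l M (U B) N a b b d ∘ ((idm _ ⊗h ι b) ⊗h idm _).
  by rewrite /eta_um /eta_l /eta_ur; assoc_r; rewrite fmap2_comp comp_id_l.
rewrite [in LHS]e1 (comp_tail (odot_assocE M (U B) N a b b d)) /eta_r; assoc_r.
rewrite (comp_tail (eta_nat _ _ _ _ _ _)); assoc_r.
rewrite -massoc_nat !(comp_tail (fmap2_comp _ _ _ _ _)) fmap_id !comp_id_l -comp_assoc.
rewrite (odot_lunitE N b d) mtriangle.
rewrite /eta_um (comp_tail (eta_nat _ _ _ _ _ _)) -comp_assoc fmap2_comp odot_runitE.
by rewrite fmap_id comp_id_l.
Qed.
End Triangle.

Definition span_bicategory :
    @Bicategory (ob S) (fun A B : S => C (A × B)) (odot H) (ucell H).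
Proof.
exact: (@Build_Bicategory (ob S) (fun A B : S => C (A × B)) (odot H) (ucell H)
  odot_assoc odot_lunit odot_runit odot_assoc_nat odot_lunit_nat odot_runit_nat
  odot_pentagon odot_triangle).
Defined.

End BicategoryOfSpans.

(** * The shadow *)

Section ShadowOfSpans.
Context (S : CatWithFiniteProducts) (C : IndexedSymMonCat S).
Context (H : IndexedHomotopyCoproducts C).

Local Notation "M ⊙ N" := (odot H _ _ _ (M, N)) (at level 36, left associativity).
Local Notation "M ⟨ a , b ⟩" := (re (pairing a b) M) (at level 8, format "M ⟨ a ,  b ⟩").
Local Notation "u ⟪ a , b ⟫" := (fmap (re (pairing a b)) u) (at level 8, format "u ⟪ a ,  b ⟫").
Local Notation "M !( X )" := (re (proj X) M) (at level 8, format "M !( X )").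
Local Notation "u !!( X )" := (fmap (re (proj X)) u) (at level 8, format "u !!( X )").
Local Notation η := (eta H).
Local Notation sh := (shadow H).
Local Notation U A := (ucell H A).
Local Notation α := (odot_assoc H).

Lemma cproj_gen : cproj (cnil S) ⋅ gen = idm (cob (cnil S)).
Proof. exact: star_uniq. Qed.

Lemma tr_eta_l_ext (A B D : S) (M : C (A × B)) (N : C (B × D)) (P : C (D × A)) (W : C star)
    (f f' : sh A ((M ⊙ N) ⊙ P) ~> W) :
  (forall (X : S) (a : X ~> A) (b : X ~> B) (d : X ~> D),
     f!!(X) ∘ (tr H ((M ⊙ N) ⊙ P) a ∘ eta_l H M N P a b d a)
     = f'!!(X) ∘ (tr H ((M ⊙ N) ⊙ P) a ∘ eta_l H M N P a b d a)) -> f = f'.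
Proof.
have u := univ_comp (univ_eta_ll H M N P (cid (cvar A)) (cid (cvar A)))
            (univ_tr H ((M ⊙ N) ⊙ P)).
move=> e; apply: (univ_hom_ext cproj_gen u) => X g; exact: e.
Qed.

Lemma tr_eta_ul_ext (A : S) (M : C (A × A)) (W : C star) (f f' : sh A (U A ⊙ M) ~> W) :
  (forall (X : S) (a : X ~> A),
     f!!(X) ∘ (tr H (U A ⊙ M) a ∘ eta_ul H M a a)
     = f'!!(X) ∘ (tr H (U A ⊙ M) a ∘ eta_ul H M a a)) -> f = f'.
Proof.
have u := univ_comp (univ_eta_ul H M (cid (cvar A)) (cid (cvar A))) (univ_tr H (U A ⊙ M)).
move=> e; apply: (univ_hom_ext cproj_gen u) => X g; exact: e.
Qed.

Lemma tr_eta_ur_ext (A : S) (M : C (A × A)) (W : C star) (f f' : sh A (M ⊙ U A) ~> W) :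
  (forall (X : S) (a : X ~> A),
     f!!(X) ∘ (tr H (M ⊙ U A) a ∘ eta_ur H M a a)
     = f'!!(X) ∘ (tr H (M ⊙ U A) a ∘ eta_ur H M a a)) -> f = f'.
Proof.
have u := univ_comp (univ_eta_ur H M (cid (cvar A)) (cid (cvar A))) (univ_tr H (M ⊙ U A)).
move=> e; apply: (univ_hom_ext cproj_gen u) => X g; exact: e.
Qed.

Definition tr_eta (A B : S) (M : C (A × B)) (N : C (B × A)) (X : S) (a : X ~> A) (b : X ~> B) :
    M⟨a, b⟩ ⊗ N⟨b, a⟩ ~> (sh A (M ⊙ N))!(X) :=
  tr H (M ⊙ N) a ∘ η M N a b a.

Lemma tr_eta_nat (A B : S) (M M' : C (A × B)) (N N' : C (B × A)) (f : M ~> M') (g : N ~> N')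
    (X : S) (a : X ~> A) (b : X ~> B) :
  (fmap (sh A) (fmap2 (odot H _ _ _) f g))!!(X) ∘ tr_eta M N a b
  = tr_eta M' N' a b ∘ (f⟪a, b⟫ ⊗h g⟪b, a⟫).
Proof. by rewrite /tr_eta (comp_tail (tr_nat _ _ _)); assoc_r; rewrite eta_nat. Qed.

Lemma univ_tr_eta (A B : S) (M : C (A × B)) (N : C (B × A)) :
  @Universal S C (cext (cvar A) B) (cnil S) (cto_nil _)
    (ften (fat2 M (cfst (cvar A) B) (csnd (cvar A) B))
          (fat2 N (csnd (cvar A) B) (cfst (cvar A) B)))
    (fatom (sh A (M ⊙ N)) (cproj (cnil S)))
    (fun X g => tr_eta M N (fst g) (snd g)).
Proof.
exact_universal (univ_comp (univ_eta H M N (cid (cvar A)) (cid (cvar A))) (univ_tr H (M ⊙ N))).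
Qed.

Lemma tr_eta_ext (A B : S) (M : C (A × B)) (N : C (B × A)) (W : C star)
    (f f' : sh A (M ⊙ N) ~> W) :
  (forall (X : S) (a : X ~> A) (b : X ~> B),
     f!!(X) ∘ tr_eta M N a b = f'!!(X) ∘ tr_eta M N a b) -> f = f'.
Proof. move=> e; apply: (univ_hom_ext cproj_gen (univ_tr_eta M N)) => X g; exact: e. Qed.

(** Both shadows represent maps out of a tensor product of M(a,b) and N(b,a), and the
    symmetry exchanges the factors. *)
Lemma rotation_exists (A B : S) (M : C (A × B)) (N : C (B × A)) :
  exists f : sh A (M ⊙ N) ~> sh B (N ⊙ M),
    forall (X : S) (a : X ~> A) (b : X ~> B),
      f!!(X) ∘ tr_eta M N a b = tr_eta N M b a ∘ msym _ _.
Proof.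
pose G := cext (cvar A) B.
pose a : CMap G (cvar A) := cfst (cvar A) B.
pose b : CMap G (cvar B) := csnd (cvar A) B.
have n1 := nat_comp (@nat_eta S C H _ _ _ N M G b a b)
             (nat_msym (F := fat2 M a b) (F' := fat2 N b a)).
have n := nat_comp (@nat_tr S C H _ (N ⊙ M) G b) n1.
have [f ef] := univ_hom_factor cproj_gen (univ_tr_eta M N) n.
exists f => X a' b'; rewrite /tr_eta -comp_assoc; exact: (ef X (a', b')).
Qed.

Lemma theta_exists (A B : S) (M : C (A × B)) (N : C (B × A)) :
  exists i : Iso (sh A (M ⊙ N)) (sh B (N ⊙ M)),
    forall (X : S) (a : X ~> A) (b : X ~> B),
      i!!(X) ∘ tr_eta M N a b = tr_eta N M b a ∘ msym _ _.
Proof.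
have [f ef] := rotation_exists M N; have [h eh] := rotation_exists N M.
have l : h ∘ f = idm _.
  apply: tr_eta_ext => X a b; rewrite fmap_comp fmap_id comp_id_l -comp_assoc ef.
  by rewrite (comp_tail (eh _ _ _)) -comp_assoc msym_involutive comp_id_r.
have r : f ∘ h = idm _.
  apply: tr_eta_ext => X a b; rewrite fmap_comp fmap_id comp_id_l -comp_assoc eh.
  by rewrite (comp_tail (ef _ _ _)) -comp_assoc msym_involutive comp_id_r.
by exists (Build_Iso l r).
Qed.

Definition sh_theta (A B : S) (M : C (A × B)) (N : C (B × A)) :
    Iso (sh A (M ⊙ N)) (sh B (N ⊙ M)) :=
  proj1_sig (constructive_indefinite_description _ (theta_exists M N)).

Local Notation θ := sh_theta.

Lemma sh_thetaE (A B : S) (M : C (A × B)) (N : C (B × A)) (X : S) (a : X ~> A) (b : X ~> B) :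
  (θ M N)!!(X) ∘ tr_eta M N a b = tr_eta N M b a ∘ msym _ _.
Proof. exact: (proj2_sig (constructive_indefinite_description _ (theta_exists M N))). Qed.

Lemma sh_theta_nat (A B : S) (M M' : C (A × B)) (N N' : C (B × A)) (f : M ~> M') (g : N ~> N') :
  fmap (sh B) (fmap2 (odot H _ _ _) g f) ∘ θ M N
  = θ M' N' ∘ fmap (sh A) (fmap2 (odot H _ _ _) f g).
Proof.
apply: tr_eta_ext => X a b; rewrite !fmap_comp; assoc_r.
rewrite sh_thetaE tr_eta_nat (comp_tail (tr_eta_nat _ _ _ _)) (comp_tail (sh_thetaE _ _ _ _)).
by assoc_r; rewrite msym_nat.
Qed.

Section Hexagon.
Context (A B D : S) (M : C (A × B)) (N : C (B × D)) (P : C (D × A)).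
Context (X : S) (a : X ~> A) (b : X ~> B) (d : X ~> D).

Lemma tr_assoc :
  (fmap (sh A) (α M N P))!!(X) ∘ (tr H ((M ⊙ N) ⊙ P) a ∘ eta_l H M N P a b d a)
  = tr H (M ⊙ (N ⊙ P)) a ∘ (eta_r H M N P a b d a ∘ massoc _ _ _).
Proof. by rewrite (comp_tail (tr_nat _ _ _)); assoc_r; rewrite odot_assocE. Qed.

Lemma theta_eta_r :
  (θ M (N ⊙ P))!!(X) ∘ (tr H (M ⊙ (N ⊙ P)) a ∘ eta_r H M N P a b d a)
  = tr H ((N ⊙ P) ⊙ M) b ∘ (eta_l H N P M b d a b ∘ msym _ _).
Proof.
have e := sh_thetaE M (N ⊙ P) a b; rewrite /tr_eta in e.
rewrite /eta_r /eta_l (comp_tail3 e); assoc_r.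
by rewrite msym_nat.
Qed.

Lemma theta_eta_l :
  (θ (M ⊙ N) P)!!(X) ∘ (tr H ((M ⊙ N) ⊙ P) a ∘ eta_l H M N P a b d a)
  = tr H (P ⊙ (M ⊙ N)) d ∘ (eta_r H P M N d a b d ∘ msym _ _).
Proof.
have e := sh_thetaE (M ⊙ N) P a d; rewrite /tr_eta in e.
rewrite /eta_r /eta_l (comp_tail3 e); assoc_r.
by rewrite msym_nat.
Qed.
End Hexagon.

(** On M(a,b) ⊗ N(b,d) ⊗ P(d,a) this is [msym_rotation]. *)
Lemma sh_theta_assoc (A B D : S) (M : C (A × B)) (N : C (B × D)) (P : C (D × A)) :
  fmap (sh D) (inv (α P M N)) ∘ θ (M ⊙ N) P
  = θ N (P ⊙ M) ∘ fmap (sh B) (α N P M) ∘ θ M (N ⊙ P) ∘ fmap (sh A) (α M N P).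
Proof.
(* With the inverse associator moved to the other side, only associators in the direction
   of [odot_assocE] remain. *)
apply: (iso_monic (i := iso_fmap (sh D) (α P M N))); rewrite (inv_r_tail (iso_fmap (sh D) (α P M N))) /=.
apply: tr_eta_l_ext => X a b d; rewrite !fmap_comp; assoc_r.
rewrite theta_eta_l (tr_assoc M N P a b d).
rewrite (comp_tail3 (theta_eta_r M N P a b d)); assoc_r.
rewrite (comp_tail3 (tr_assoc N P M b d a)); assoc_r.
rewrite (comp_tail3 (theta_eta_r N P M b d a)); assoc_r.
rewrite (comp_tail3 (tr_assoc P M N d a b)); assoc_r.
have e := msym_rotation (M⟨a, b⟩) (N⟨b, d⟩) (P⟨d, a⟩).
by rewrite -!comp_assoc in e; rewrite -e inv_r_tail.
Qed.

Lemma sh_theta_runit (A : S) (M : C (A × A)) :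
  fmap (sh A) (odot_lunit H M) ∘ θ M (U A) = fmap (sh A) (odot_runit H M).
Proof.
apply: tr_eta_ur_ext => X a; rewrite fmap_comp; assoc_r.
have e := sh_thetaE M (U A) a a; rewrite /tr_eta in e.
rewrite [in LHS]/eta_ur (comp_tail3 e); assoc_r; rewrite -msym_nat.
rewrite (comp_tail (tr_nat _ _ _)); assoc_r.
have e2 := odot_lunitE H M a a; rewrite /eta_ul in e2; rewrite (comp_tail3 e2) mlunit_msym.
by rewrite (comp_tail (tr_nat _ _ _)) -comp_assoc odot_runitE.
Qed.

Lemma sh_theta_lunit (A : S) (M : C (A × A)) :
  fmap (sh A) (odot_runit H M) ∘ θ (U A) M = fmap (sh A) (odot_lunit H M).
Proof.
apply: tr_eta_ul_ext => X a; rewrite fmap_comp; assoc_r.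
have e := sh_thetaE (U A) M a a; rewrite /tr_eta in e.
rewrite [in LHS]/eta_ul (comp_tail3 e); assoc_r; rewrite -msym_nat.
rewrite (comp_tail (tr_nat _ _ _)); assoc_r.
have e2 := odot_runitE H M a a; rewrite /eta_ur in e2; rewrite (comp_tail3 e2) mrunit_msym.
by rewrite (comp_tail (tr_nat _ _ _)) -comp_assoc odot_lunitE.
Qed.

Definition span_shadow :
    @Shadow (ob S) (fun A B : S => C (A × B)) (odot H) (ucell H) (span_bicategory H)
      (C star) (shadow H).
Proof.
exact: (@Build_Shadow (ob S) (fun A B : S => C (A × B)) (odot H) (ucell H) (span_bicategory H)
  (C star) (shadow H) sh_theta sh_theta_nat sh_theta_assoc sh_theta_runit sh_theta_lunit).
Defined.

End ShadowOfSpans.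

Theorem theorem5p2 (S : CatWithFiniteProducts) (C : IndexedSymMonCat S)
    (H : IndexedHomotopyCoproducts C) :
  exists B : @Bicategory (ob S) (fun A B : S => C (bprod A B)) (odot H) (ucell H),
    inhabited (@Shadow (ob S) (fun A B : S => C (bprod A B)) (odot H) (ucell H) B
                 (C star) (shadow H)).
Proof. by exists (span_bicategory H); split; exact: span_shadow. Qed.
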